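(* Let $c>0$, $a=(1-\sqrt c)^2$, $b=(1+\sqrt c)^2$ and $P(z)=(z-a)(z-b)$. Let $m_n=\sum_{\pi\in NC(n)}c^{\#(\pi)}$ and $\overline m_n'=\sum_{\pi\in S_{NC}^\delta(n,-n)}c^{\#(\pi)/2}$ for $n\ge1$, and let $$G(z)=\frac1z+\sum_{n=1}^\infty\frac{m_n}{z^{n+1}}=\frac{z+1-c-\sqrt{P(z)}}{2z},\qquad g(z)=\sum_{n=1}^\infty\frac{\overline m_n'}{z^{n+1}}.$$ Then, for complex $z$ with $|z|$ sufficiently large, $$g(z)=\frac{zG(z)-1}{P(z)}=\frac12\left\{\frac12\Big(\frac1{z-a}+\frac1{z-b}\Big)-\frac1{\sqrt{(z-a)(z-b)}}\right\}.$$
   Context: $G$ is the Cauchy transform of the Marchenko–Pastur law with parameter $c$. $\sqrt{P(z)}=\sqrt{(z-a)(z-b)}$ denotes the branch analytic on $\mathbb{C}\setminus[a,b]$ with $\sqrt{P(z)}/z\to1$ as $z\to\infty$. $NC(n)$ is the set of non-crossing partitions of $[n]=\{1,\dots,n\}$; for a partition $\#(\pi)$ is the number of blocks; for a permutation $\#(\pi)$ is the number of cycles (fixed points included). Let $[\pm n]=\{\pm1,\dots,\pm n\}$ and let $S_{\pm n}$ be its symmetric group (products composed right to left). Let $\delta\in S_{\pm n}$, $\delta(k)=-k$; let $\gamma\in S_{\pm n}$ be the cycle $(1,2,\dots,n)$, acting trivially on negative numbers; put $\tilde\gamma=\gamma\delta\gamma^{-1}\delta=(1,2,\dots,n)(-n,\dots,-2,-1)$.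 A pairing is a permutation all of whose cycles have length 2. $S_{NC}^\delta(n,-n)$ is the set of $\sigma\in S_{\pm n}$ such that (1) the subgroup $\langle\sigma,\tilde\gamma\rangle$ acts transitively on $[\pm n]$; (2) $\#(\sigma)+\#(\sigma^{-1}\tilde\gamma)=2n$; (3) $\sigma\delta$ is a pairing. *)

(* Defs.v *)
From HB Require Import structures.
From mathcomp Require Import all_boot all_order all_algebra all_fingroup.
From mathcomp Require Import complex.
From mathcomp Require Import all_classical all_reals all_analysis.

Set Implicit Arguments.
Unset Strict Implicit.
Unset Printing Implicit Defensive.

Import Order.TTheory GRing.Theory Num.Theory.
Import numFieldNormedType.Exports.

Local Open Scope ring_scope.
Local Open Scope complex_scope.

Definition noncrossing (n : nat) (p : {set {set 'I_n}}) : bool :=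
  [forall B in p, forall B' in p,
     [exists i in B, exists j in B', exists k in B, exists l in B',
        (i < j)%N && (j < k)%N && (k < l)%N] ==> (B == B')].

Definition NC (n : nat) : {set {set {set 'I_n}}} :=
  [set p : {set {set 'I_n}} | finset.partition p [set: 'I_n] && noncrossing p]%SET.

(* The index set {1, .., n, -1, .., -n}: (false, k) stands for k + 1 and      *)
(* (true, k) for -(k + 1).                                                    *)
Notation pm n := (bool * 'I_n)%type.

Definition delta_fun (n : nat) (x : pm n) : pm n := (~~ x.1, x.2).

Lemma delta_fun_inj (n : nat) : injective (@delta_fun n).
Proof. by move=> [e i] [f j] [/negb_inj -> ->]. Qed.

Definition delta (n : nat) : {perm pm n} := perm (@delta_fun_inj n).

Definition gamma_fun (n : nat) (x : pm n) : pm n :=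
  if x.1 then x else (false, ordS x.2).

Lemma gamma_fun_inj (n : nat) : injective (@gamma_fun n).
Proof.
by move=> [[] i] [[] j]; rewrite /gamma_fun //= => /(congr1 snd) /ordS_inj ->.
Qed.

Definition gamma (n : nat) : {perm pm n} := perm (@gamma_fun_inj n).

(* Right-to-left product, (s \oR t) x = s (t x); the group law of {perm T}    *)
(* composes from left to right.                                               *)
Definition rtl_mul (T : finType) (s t : {perm T}) : {perm T} := (t * s)%g.

Notation "s \oR t" := (rtl_mul s t) (at level 40, left associativity).

Definition tgamma (n : nat) : {perm pm n} :=
  gamma n \oR delta n \oR (gamma n)^-1%g \oR delta n.

Definition pairing (T : finType) (s : {perm T}) : bool :=
  [forall x, #|porbit s x| == 2%N].

Definition SNCdelta (n : nat) : {set {perm pm n}} :=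
  [set s : {perm pm n} |
     [&& [transitive <<[set s; tgamma n]>>%g, on [set: pm n] | 'P],
         (#|porbits s| + #|porbits (s^-1%g \oR tgamma n)| == 2 * n)%N
       & pairing (s \oR delta n)]]%SET.

Definition mp_moment (R : realType) (c : R) (n : nat) : R :=
  \sum_(p in NC n) c ^+ #|p|.

Definition mp_moment' (R : realType) (c : R) (n : nat) : R :=
  \sum_(s in SNCdelta n) c `^ (#|porbits s|%:R / 2).

Definition mp_a (R : realType) (c : R) : R := (1 - Num.sqrt c) ^+ 2.

Definition mp_b (R : realType) (c : R) : R := (1 + Num.sqrt c) ^+ 2.

Local Open Scope classical_set_scope.

(* R[i]^o is R[i] with its topology as a normed space over itself.            *)
Definition mp_P (R : realType) (c : R) (z : R[i]^o) : R[i]^o :=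
  (z - (mp_a c)%:C) * (z - (mp_b c)%:C).

(* The filter z --> oo in the complex plane.                                  *)
Definition cinfty (R : realType) : set_system R[i]^o :=
  [set A | exists r : R, forall z : R[i]^o, r%:C < `|z| -> A z].
Arguments cinfty R : clear implicits.

#[global] Instance cinfty_filter (R : realType) : ProperFilter (cinfty R).
Proof.
split.
  move=> [r] /(_ (`|r| + 1)%:C); apply.
  rewrite ger0_norm ?lecR ?addr_ge0 ?normr_ge0 ?ler01 //.
  by rewrite ltcR (le_lt_trans (ler_norm r)) // ltrDl ltr01.
split=> [|A B [r hr] [s hs]|A B AB [r hr]]; first by exists 0.
  exists (Num.max r s) => z; split.
    by apply: hr; rewrite (le_lt_trans _ H) ?lecR ?le_max ?lexx.
  by apply: hs; rewrite (le_lt_trans _ H) ?lecR ?le_max ?lexx ?orbT.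
by exists r => z /hr /AB.
Qed.

(* Derivability in direction 1 over the scalar field R[i] is complex           *)
(* differentiability; s is unconstrained on the cut [a, b].                   *)
Definition is_sqrtP (R : realType) (c : R) (s : R[i]^o -> R[i]^o) : Prop :=
  let cut : set R[i]^o := [set t%:C | t in `[mp_a c, mp_b c]] in
  [/\ forall z, ~ cut z -> derivable s z 1,
      forall z, ~ cut z -> s z ^+ 2 = mp_P c z
    & s z / z @[z --> cinfty R] --> (1 : R[i]^o)].

Definition Gsum (R : realType) (c : R) (z : R[i]^o) : nat -> R[i]^o :=
  fun N => \sum_(1 <= n < N) (mp_moment c n)%:C / z ^+ n.+1.

Definition gsum (R : realType) (c : R) (z : R[i]^o) : nat -> R[i]^o :=
  fun N => \sum_(1 <= n < N) (mp_moment' c n)%:C / z ^+ n.+1.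

Definition mp_G (R : realType) (c : R) (z : R[i]^o) : R[i]^o :=
  1 / z + limn (Gsum c z).

Definition mp_g (R : realType) (c : R) (z : R[i]^o) : R[i]^o := limn (gsum c z).

(* Main.v *)
Require Import Defs.
From mathcomp Require Import all_boot all_order all_algebra all_fingroup.
From mathcomp Require Import zify ring lra.

(** Throughout, [s] in S_NC^delta(n,-n) is replaced by the matching (fixed-point-free involution)
[p = s delta] of the 2n signed points. With [d = delta] and [t = tgamma delta], again matchings,
[s] has as many cycles as [p d], and [s^-1 tgamma] as many as [p t], so the weight and the
counting condition are functions of the three matchings. The edges of [d] and [t] alternate
along a single polygon with 2n vertices; [p] glues its vertices in pairs, and
[#(p d) + #(p t)] is governed by the Euler characteristic of the resulting surface: it is at
most 2n + 2, the value 2n + 2 belongs to the sphere and 2n to the projective plane. An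
orientable gluing has the wrong parity for the value 2n, and a non-orientable one makes
[<s, tgamma>] transitive; transitivity is therefore automatic ([mem_SNCdelta]).

The sum over matchings is computed by removing a pair [v, w = p v]: reconnecting [d] and [t]
around the pair ([switch]) changes the two cycle counts in a way that depends on [d v = w] and
[t v = w] only, while [p] itself stays the same. This gives an exact recursion for any family
of polygons ([matching_sum_rec]), in which the polygon of [v] is cut into two, is cut and
reglued with a twist, or is merged with another one. By induction on the number of vertices
([matching_sum_leading]) the generating polynomial of a family has a leading coefficient that
is the product of numbers [M_n] over the polygons, and a next coefficient that is obtained
from this product by the Leibniz rule for a second sequence [M'_n]: a cut contributes to both,
a twist only to the second, a merge to none. With [M~_0 = c] and [M~_i = M_i] for i > 0,
  [M_(n+1) = sum_i M~_i M_(n-i)],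
  [M'_(n+1) = sum_i (M'_i M_(n-i) + M~_i M'_(n-i)) + n M_n].
The second sequence is [mp_moment'] ([mp_moment'_leading]). The first one is [mp_moment]: in a
non-crossing partition of {0, .., n}, the successor [k] of 0 in its block separates the
partition into one of {1, .., k-1} and one of {k, .., n} ([NCsumS]).

In terms of [w = 1/z], [F = sum M_n w^n], [D = sum n M_n w^n] and [H = sum M'_n w^n], the
recursions read [F = 1 + w F (F + c - 1)], [D u = F - 1] and [H u = w D] with
[u = 1 - w (c - 1) - 2 w F]. The quadratic equation has the roots
[L, L' = (z + 1 - c -+ sqrtP z) / 2], so that [F = L] means [z G = L], and then [u = sqrtP z / z]
and [g = H / z = (L - 1) / P z]; the last expression is what the closed formula expands to.
The partial sums satisfy these equations up to null sequences, because the coefficients grow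
geometrically, which gives convergence without appeal to completeness ([psum_m_cvg],
[psum_d_cvg], [psum_m'_cvg]): the partial sums of [F] are bounded by 2 whereas
[sqrtP z / z --> 1] forces [|L'| >= 3], so they must approach [L]. *)

Set Implicit Arguments.
Unset Strict Implicit.
Unset Printing Implicit Defensive.

Import Order.TTheory GRing.Theory Num.Theory.
Local Open Scope ring_scope.

(** * Matchings, switches and the recursion for sums over matchings *)

Section Matchings.
Variable T : finType.
Implicit Types (d t p : {perm T}) (v w x y : T).

Definition matching p := [forall x, (p (p x) == x) && (p x != x)].

Lemma matchingK p : matching p -> involutive p.
Proof. by move=> /forallP mp x; case/andP: (mp x) => /eqP. Qed.

Lemma matching_neq p x : matching p -> p x != x.
Proof. by move=> /forallP /(_ x) /andP[]. Qed.

Lemma matching_eqC p x y : matching p -> (p x == y) = (x == p y).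
Proof. by move=> mp; apply/eqP/eqP => [<-|->]; rewrite matchingK. Qed.

(** Conjugation by a transposition swaps the partners of [w] and [d v]: the pairs {v, d v} and
    {w, d w} become {v, w} and {d v, d w}. Keeping {v, w} as a pair, rather than deleting the
    two points, leaves the carrier type unchanged and makes the case [d v = w] uniform. *)
Definition switch d v w := (d ^ tperm w (d v))%g.

Lemma switchE d v w x :
  switch d v w x = tperm w (d v) (d (tperm w (d v) x)).
Proof. by rewrite /switch /conjg tpermV !permM. Qed.

Section Switch.
Variables (d : {perm T}) (v w : T).
Hypotheses (md : matching d) (vw : v != w).

Lemma switch_matching : matching (switch d v w).
Proof.
apply/forallP => x; rewrite !switchE tpermK matchingK // tpermK eqxx /=.
by apply: contra (matching_neq (tperm w (d v) x) md) => /eqP {2}<-; rewrite tpermK.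
Qed.

Lemma switchR : switch d v w w = v.
Proof.
by rewrite switchE tpermL matchingK // tpermD // ?matching_neq // eq_sym.
Qed.

Lemma switchL : switch d v w v = w.
Proof. by rewrite -{2}switchR matchingK // switch_matching. Qed.

Lemma switch_dL : switch d v w (d v) = d w.
Proof.
by rewrite switchE tpermR tpermD // 1?eq_sym ?matching_neq// (inj_eq perm_inj) eq_sym.
Qed.

Lemma switch_dR : switch d v w (d w) = d v.
Proof. by rewrite -switch_dL matchingK // switch_matching. Qed.

Lemma switchD x :
  x != v -> x != w -> x != d v -> x != d w -> switch d v w x = d x.
Proof.
move=> xv xw xdv xdw.
rewrite switchE [tperm _ _ x]tpermD 1?eq_sym// tpermD //.
  by rewrite -matching_eqC // eq_sym.
by rewrite (inj_eq perm_inj) eq_sym.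
Qed.

(** If [d v != w], then [switch d v w * p] is obtained from [d * p] by multiplication with two
    transpositions, which split off [v] and [w] as fixed points. *)
Lemma porbits_switch p : matching p -> p v = w ->
  #|porbits (switch d v w * p)%g| = (#|porbits (d * p)%g| + (d v != w).*2)%N.
Proof.
move=> mp pv; have pw : p w = v by rewrite -pv matchingK.
rewrite /switch; have [->|dvw] := eqVneq (d v) w.
  by rewrite tperm1 conjg1 addn0.
have dwv : d w != v by rewrite matching_eqC // eq_sym.
set q := (d * p)%g.
have -> : (d ^ tperm w (d v) * p = tperm w (d v) * (tperm (d w) v * q))%g.
  rewrite /q !mulgA; congr (_ * p)%g; rewrite /conjg tpermV -!mulgA; congr (_ * _)%g.
  have dV : (d^-1 = d)%g by apply: mulg1_eq; apply/permP=> x; rewrite permM perm1 matchingK.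
  by rewrite conjgCV tpermJ dV matchingK.
(* q maps d w to v, so these two points are consecutive on a cycle *)
have := porbits_mul_tperm q (d w) v; rewrite dwv /=.
have -> : d w \in porbit q v.
  have <- : q (d w) = v by rewrite permM matchingK.
  by rewrite porbit_sym (mem_porbit _ 1).
rewrite /= addn0 => E1.
have := porbits_mul_tperm (tperm (d w) v * q)%g w (d v).
have -> : w \in porbit (tperm (d w) v * q)%g (d v).
  suff {1}<- : (tperm (d w) v * q)%g (d v) = w by rewrite (mem_porbit _ 1).
  rewrite permM tpermD ?permM ?matchingK //.
    by rewrite (inj_eq perm_inj) eq_sym.
  by rewrite eq_sym matching_neq.
rewrite /= addn0 E1 [w == _]eq_sym dvw /= => ->.
by rewrite -addnA.
Qed.

End Switch.

Section Weight.
Variables (R : fieldType) (s : R).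

(** Points outside [S] are frozen: they have been matched by earlier switches. *)
Definition agree (S : {pred T}) d p := [forall x, (x \in S) || (p x == d x)].

Definition matching_sum (D : nat) (S : {pred T}) d t : R :=
  \sum_(p | [&& matching p, agree S d p &
      (#|porbits (d * p)%g| + #|porbits (t * p)%g| == D)%N])
    s ^+ #|porbits (d * p)%g|.

(** The matchings with [p v = w] that agree with [d] off [U] are exactly those that agree with
    [switch d v w] off [U] minus {v, w}; the sum is merely partitioned by the value [p v]. *)
Lemma matching_sum_rec D (S : T -> {pred T}) d t v (U : {pred T}) :
  s != 0 -> matching d -> matching t -> v \in U ->
  {in U, forall x, d x \in U} ->
  (forall w x, w \in U -> w != v -> (x \in S w) = [&& x \in U, x != v & x != w]) ->
  matching_sum D U d t = \sum_(w | (w \in U) && (w != v))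
     s ^- ((d v != w).*2) *
     matching_sum (D + (d v != w).*2 + (t v != w).*2) (S w) (switch d v w) (switch t v w).
Proof.
move=> s0 md mt vU dU SE.
rewrite /matching_sum.
rewrite (partition_big (fun p : {perm T} => p v) (fun w => (w \in U) && (w != v))) /=.
  apply: eq_bigr => w /andP[wU wv].
  have vw : v != w by rewrite eq_sym.
  rewrite big_distrr /=; apply: eq_big => p; last first.
    case/andP=> /and3P[mp _ _] /eqP pv.
    by rewrite porbits_switch // exprD mulrCA mulVf ?mulr1 // expf_neq0.
  rewrite andbC andbCA; case: (boolP (matching p)) => //= mp.
  apply/idP/idP.
    case/and3P=> /eqP pv ag E.
    rewrite !porbits_switch // addnACA (eqP E) addnA eqxx andbT.
    apply/forallP => x; rewrite SE //.
    have [->|xv] := eqVneq x v; first by rewrite switchL // pv eqxx orbT.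
    have [->|xw] := eqVneq x w.
      by rewrite switchR // -pv matchingK // eqxx orbT.
    rewrite !andbT; have := forallP ag x; case: (boolP (x \in U)) => //= xU.
    rewrite switchD //; first by apply: contra xU => /eqP ->; exact: dU.
    by apply: contra xU => /eqP ->; exact: dU.
  case/andP=> ag.
  have pv : p v = w.
    have := forallP ag v; rewrite SE // eqxx andbF /= => /eqP ->.
    by rewrite switchL.
  rewrite !porbits_switch // addnACA addnA !eqn_add2r pv eqxx /= => ->.
  rewrite andbT; apply/forallP => x; have := forallP ag x; rewrite SE //.
  case: (boolP (x \in U)) => //= xU.
  rewrite switchD //; apply: contraNN xU => /eqP ->//; exact: dU.
move=> p /and3P[mp ag _]; rewrite matching_neq // andbT.
apply/negPn/negP => pvU; have := forallP ag (p v).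
rewrite (negbTE pvU) /= matchingK // => /eqP vE.
by move: pvU; rewrite -[p v](matchingK md) -vE dU.
Qed.

End Weight.

(** * Polygons traced by two matchings *)

Lemma sub_path_belast (e e' : rel T) x (s : seq T) : path e x s ->
  (forall z u, z \in belast x s -> u \in s -> e z u -> e' z u) -> path e' x s.
Proof.
elim: s x => //= z s IHs x /andP[xz es] ee'.
rewrite ee' ?mem_head //=; apply: IHs => // u1 u2 us1 us2.
by apply: ee'; rewrite inE ?us1 ?us2 orbT.
Qed.

Lemma fpath_belast (f g : T -> T) x (s : seq T) : fpath f x s ->
  (forall z, z \in belast x s -> f z \in s -> g z = f z) -> fpath g x s.
Proof.
move=> /sub_path_belast fs fg; apply: fs => z u zs us /eqP fz /=.
by rewrite fg ?fz ?eqxx.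
Qed.

(** Two steps along the polygon whose edges alternate between [d] and [t]. *)
Definition turn d t : T -> T := t \o d.

(** A polygon is stored as a cycle of [turn d t], which visits every other vertex; the
    remaining vertices are the images under [d]. *)
Definition half_set d (X : seq T) := uniq X /\ {in X, forall x, d x \notin X}.

Definition points d (X : seq T) : {pred T} := [pred x | (x \in X) || (d x \in X)].

Section Surgery.
Variables (d t : {perm T}) (X : seq T) (v y : T).
Hypotheses (md : matching d) (mt : matching t) (trX : half_set d X).
Hypotheses (vX : v \in X) (yX : y \in X).
Let w := d y.
Let d' := switch d v w.
Let t' := switch t v w.

Let dX x : x \in X -> d x \notin X. Proof. exact: trX.2. Qed.

Let vw : v != w. Proof. by apply: contraTneq vX => ->; exact: dX. Qed.

(** When [w = d y] with [y] in the half set, removing [v] leaves a half set for the switched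
    matching, because the switch pairs [y] with [d v]. *)
Lemma switch_points X' : uniq X' -> X' =i [predD1 X & v] ->
  half_set d' X' /\ forall x, (x \in points d' X') = [&& x \in points d X, x != v & x != w].
Proof.
move=> uX' X'E.
have wX : w \notin X by exact: dX.
have dw : d w = y by rewrite matchingK.
have dvX : d v \notin X by exact: dX.
have d'X x : x \in X -> x != v -> d' x = if x == y then d v else d x.
  move=> xX xv; case: (eqVneq x y) => [->|xy]; first by rewrite -dw /d' switch_dR.
  rewrite /d' switchD ?dw //; first by apply: contraNneq wX => <-.
  by apply: contraNneq dvX => <-.
split.
  split=> // x; rewrite X'E !inE => /andP[xv xX]; rewrite X'E inE negb_and.
  rewrite d'X //; case: ifP => _; first by rewrite dvX orbT.
  by rewrite dX ?orbT.
move=> x; rewrite !inE !X'E !inE.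
have [->|xv] /= := eqVneq x v.
  by rewrite /d' switchL // (negbTE wX) !andbF.
have [->|xw] /= := eqVneq x w.
  by rewrite /d' switchR // eqxx /= (negbTE wX) !andbF.
rewrite andbT; case: (boolP (x \in X)) => //= xX.
have [xdv|xdv] := eqVneq x (d v).
  rewrite /d' xdv switch_dL // dw matchingK // vX yX andbT.
  by apply: contraNneq xw => yv; rewrite /w yv xdv.
rewrite /d' switchD ?dw //; last by apply: contraNneq xX => ->.
by rewrite matching_eqC // xdv.
Qed.

(** The switched turn skips [v] and exchanges the successors of [v] and [y], so it splits the
    cycle of [v] when [y] lies on it and joins the two cycles otherwise. *)
Lemma turn_switch :
  {in X, forall x, turn d t x \in X} ->
  [/\ {in X, forall x, x != v -> x != y -> turn d t x != v ->
         turn d' t' x = turn d t x},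
     {in X, forall x, x != v -> x != y -> turn d t x = v ->
         turn d' t' x = turn d t y},
     y != v -> turn d t v != v -> turn d' t' y = turn d t v
   & y != v -> turn d t v = v -> turn d' t' y = turn d t y].
Proof.
rewrite /turn /= => phiX.
have wX : w \notin X by exact: dX.
have dw : d w = y by rewrite matchingK.
have dvX : d v \notin X by exact: dX.
have d'X x : x \in X -> x != v -> x != y -> d' x = d x.
  move=> xX xv xy.
  rewrite /d' switchD ?dw //; first by apply: contraNneq wX => <-.
  by apply: contraNneq dvX => <-.
have d'y : d' y = d v by rewrite -dw /d' switch_dR.
have t'D z : z != v -> z != w -> t z != v -> t z != w -> t' z = t z.
  by move=> zv zw tzv tzw; rewrite /t' switchD // -matching_eqC.
have dv x : x \in X -> d x != v by move=> xX; apply: contraTneq vX => <-; exact: dX.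
split.
- move=> x xX xv xy pv; rewrite d'X // t'D //; first exact: dv.
    by rewrite (inj_eq perm_inj).
  by apply: contraNneq wX => <-; exact: phiX.
- move=> x xX xv xy pv; rewrite d'X //; have -> : d x = t v by rewrite -pv matchingK.
  by rewrite /t' switch_dL.
- move=> yv pv; rewrite d'y t'D //; first exact: dv.
    by rewrite (inj_eq perm_inj) eq_sym.
  by apply: contraNneq wX => <-; exact: phiX.
- move=> yv pv; rewrite d'y; have -> : d v = t v by rewrite -{2}pv matchingK.
  by rewrite /t' switch_dL.
Qed.

Hypothesis turnX : {in X, forall x, turn d t x \in X}.

Lemma fcycle_switch_other s : {subset s <= X} -> v \notin s -> y \notin s ->
  fcycle (turn d t) s -> fcycle (turn d' t') s.
Proof.
move=> sX vs ys cs; have [tsD _ _ _] := turn_switch turnX.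
apply: (@sub_in_cycle _ [in s] (frel (turn d t))) (cs); last by apply/allP.
move=> x z xs _ /=; rewrite tsD ?sX //.
- by apply: contraNneq vs => <-.
- by apply: contraNneq ys => <-.
by apply: contraNneq vs => <-; exact: mem_fcycle.
Qed.

Lemma fpath_switch z s : {subset z :: s <= X} -> v \notin z :: s ->
  uniq (z :: s) -> y \notin belast z s ->
  fpath (turn d t) z s -> fpath (turn d' t') z s.
Proof.
move=> sX vs us yb c; have [tsD _ _ _] := turn_switch turnX.
apply: (fpath_belast c) => x xb xs; apply: tsD.
- exact/sX/mem_belast.
- by apply: contraNneq vs => <-; exact: mem_belast.
- by apply: contraNneq yb => <-.
by apply: contraNneq vs => <-; rewrite inE xs orbT.
Qed.

Lemma fcycle_switch_split s1 s2 : uniq (v :: s1 ++ s2) -> {subset v :: s1 ++ s2 <= X} ->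
  y = last v s1 -> fcycle (turn d t) (v :: s1 ++ s2) ->
  fcycle (turn d' t') s1 /\ fcycle (turn d' t') s2.
Proof.
move=> us sX yE; have [tsD tsv tsy tsyv] := turn_switch turnX.
rewrite /= -cats1 -catA cat_path -yE => /andP[]; move: us => /= /andP[].
rewrite mem_cat negb_or cat_uniq => /andP[vs1 vs2] /and3P[us1 dis us2] c1 c2.
have sX1 : {subset s1 <= X} by move=> x xs; apply: sX; rewrite inE mem_cat xs orbT.
have sX2 : {subset s2 <= X} by move=> x xs; apply: sX; rewrite inE mem_cat xs !orbT.
split.
  case: s1 yE c1 vs1 us1 sX1 {sX dis} => //= z s1 yE /andP[/eqP vz c1] vs us1 sX1.
  have yv : y != v by apply: contraNneq vs => <-; rewrite yE mem_last.
  rewrite rcons_path; apply/andP; split; last first.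
    rewrite /= -yE tsy //; first exact/eqP.
    by apply: contraNneq vs => <-; rewrite vz mem_head.
  apply: fpath_switch => //.
  by move: us1; rewrite -[_ && _]/(uniq (z :: s1)) lastI rcons_uniq -yE => /andP[].
have ys2 : y \notin s2.
  move: (mem_last v s1); rewrite -yE inE => /predU1P[->//|ys1].
  by apply: contra dis => ys2; apply/hasP; exists y.
case: s2 c2 vs2 us2 sX2 ys2 {sX dis} => //= z s2.
rewrite cats1 rcons_path => /and3P[/eqP yz c2 /eqP c3] vs us sX2 ys.
rewrite rcons_path; apply/andP; split; last first.
  rewrite /= tsv ?yz //; first exact/sX2/mem_last.
    by apply: contraNneq vs => <-; exact: mem_last.
  by apply: contraNneq ys => <-; exact: mem_last.
by apply: fpath_switch => //; apply: contra ys => /mem_belast.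
Qed.

Lemma fcycle_switch_merge s1 s2 : uniq (v :: s1 ++ s2) -> {subset v :: s1 ++ s2 <= X} ->
  s2 != [::] -> y = last v s2 -> fcycle (turn d t) (v :: s1) -> fcycle (turn d t) s2 ->
  fcycle (turn d' t') (s1 ++ s2).
Proof.
move=> us sX; have [tsD tsv tsy tsyv] := turn_switch turnX.
case: s2 us sX => //= z s2 us sX _ yE; rewrite !rcons_path.
move=> /andP[c1 /eqP c1'] /andP[c2 /eqP c2'].
move: us; rewrite mem_cat negb_or cat_uniq => /and3P[/andP[vs1 vs2] us1 /andP[dis us2]].
have sX1 : {subset s1 <= X} by move=> x xs; apply: sX; rewrite inE mem_cat xs orbT.
have sX2 : {subset z :: s2 <= X} by move=> x xs; apply: sX; rewrite inE mem_cat xs !orbT.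
have yv : y != v by apply: contraNneq vs2 => <-; rewrite yE mem_last.
have ys1 : y \notin s1.
  by apply: contra dis => ys1; apply/hasP; exists y; rewrite // yE; exact: mem_last.
have c2s : fpath (turn d' t') z s2.
  by apply: fpath_switch => //; move: us2; rewrite lastI rcons_uniq -yE => /andP[].
case: s1 vs1 us1 c1 c1' sX1 ys1 {sX dis} => [|u s1] vs1 us1 c1 c1' sX1 ys1 /=.
  by rewrite rcons_path c2s /= -yE tsyv // yE; exact/eqP.
rewrite rcons_path cat_path last_cat /= c2s /=.
move: c1 => /= /andP[/eqP vu c1].
rewrite fpath_switch //=; last by apply: contra ys1 => /mem_belast.
rewrite tsv //.
- rewrite -yE tsy // ?vu; first by rewrite yE c2' !eqxx.
  by apply: contraNneq vs1 => <-; rewrite mem_head.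
- exact/sX1/mem_last.
- by apply: contraNneq vs1 => <-; exact: mem_last.
by apply: contraNneq ys1 => <-; exact: mem_last.
Qed.
End Surgery.

Section Twist.
Variables (d t : {perm T}) (X : seq T) (v w : T).
Hypotheses (md : matching d) (mt : matching t) (trX : half_set d X).
Hypotheses (vX : v \in X) (wX : w \in X) (vw : v != w).
Let d' := switch d v w.
Let t' := switch t v w.

Let dX x : x \in X -> d x \notin X. Proof. exact: trX.2. Qed.

Let d'X x : x \in X -> x != v -> x != w -> d' x = d x.
Proof.
move=> xX xv xw; rewrite /d' switchD //.
  by apply: contraTneq xX => ->; exact: dX.
by apply: contraTneq xX => ->; exact: dX.
Qed.

Lemma turn_twistD x : x \in X -> x != v -> x != w -> turn d t x != v -> turn d t x != w ->
  turn d' t' x = turn d t x.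
Proof.
rewrite /turn /= => xX xv xw tv tw; rewrite d'X // /t' switchD //.
- by apply: contraTneq vX => <-; exact: dX.
- by apply: contraTneq wX => <-; exact: dX.
- by rewrite -matching_eqC.
by rewrite -matching_eqC.
Qed.

Lemma fcycle_twist_other s : {subset s <= X} -> v \notin s -> w \notin s ->
  fcycle (turn d t) s -> fcycle (turn d' t') s.
Proof.
move=> sX vs ws cs.
apply: (@sub_in_cycle _ [in s] (frel (turn d t))) (cs); last by apply/allP.
move=> x z xs _ /=; have xs' := mem_fcycle cs xs.
rewrite turn_twistD ?sX //.
- by apply: contraNneq vs => <-.
- by apply: contraNneq ws => <-.
- by apply: contraNneq vs => <-.
by apply: contraNneq ws => <-.
Qed.

(** When [v] and [w] lie in the same half, the arc from [w] back to [v] is traversed backwards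
    after the switch, hence through the opposite vertices. *)
Lemma fcycle_twist s1 s2 : uniq (v :: s1 ++ w :: s2) -> {subset v :: s1 ++ w :: s2 <= X} ->
  fcycle (turn d t) (v :: s1 ++ w :: s2) ->
  fcycle (turn d' t') (s1 ++ map d (rev (w :: s2))).
Proof.
move=> us sX; rewrite /= -cats1 -catA cat_path /= => /and3P[c1 c2].
rewrite cats1 rcons_path => /andP[c3 c4].
move: us => /= /andP[]; rewrite mem_cat inE !negb_or cat_uniq /= negb_or.
move=> /and3P[vs1 _ vs2] /and4P[us1 /andP[ws1 dis] ws2 us2].
have sX1 : {subset s1 <= X} by move=> x xs; apply: sX; rewrite inE mem_cat xs orbT.
have sX2 : {subset s2 <= X} by move=> x xs; apply: sX; rewrite inE mem_cat inE xs !orbT.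
set L := last w s2 in c4.
have LX : L \in X by have := mem_last w s2; rewrite -/L inE => /predU1P[->//|/sX2].
have tv : t v = d L by rewrite -(eqP c4) /turn /= matchingK.
have eX : last v s1 \in X by have := mem_last v s1; rewrite inE => /predU1P[->//|/sX1].
have tw : t w = d (last v s1) by rewrite -(eqP c2) /turn /= matchingK.
have t'e : t' (d (last v s1)) = d L by rewrite -tw -tv /t' switch_dR.
have c3' : fpath (turn d' t') (d L) (map d (rev (belast w s2))).
  rewrite path_map rev_path; apply: sub_path_belast (c3) _ => z u zs us /= /eqP zu.
  have uX : u \in X by exact: sX2.
  have uv : u != v by apply: contraNneq vs2 => <-.
  have uw : u != w by apply: contraNneq ws2 => <-.
  have d'du : d' (d u) = u.
    rewrite /d' switchD ?matchingK ?(inj_eq perm_inj) //.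
      by apply: contraTneq vX => <-; exact: dX.
    by apply: contraTneq wX => <-; exact: dX.
  rewrite /turn /= d'du /t' switchD //.
  - by rewrite -zu /turn /= matchingK.
  - by apply: contraTneq uX => ->; rewrite tv; exact: dX.
  by apply: contraTneq uX => ->; rewrite tw; exact: dX.
have -> : rev (w :: s2) = L :: rev (belast w s2) by rewrite lastI rev_rcons.
have lastE : last (d L) (map d (rev (belast w s2))) = d w.
  by rewrite last_map /L; case: (s2) => //= z s; rewrite rev_cons last_rcons.
have d'dw : d' (d w) = d v by rewrite /d' switch_dR.
case: s1 vs1 ws1 us1 c1 c2 dis sX1 eX tw t'e {sX} => [|z s1] vs1 ws1 us1 c1 c2 dis sX1 eX tw t'e.
  by rewrite /= rcons_path c3' lastE /= /turn /= d'dw t'e.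
move: c1 => /= /andP[/eqP vz c1].
rewrite rcons_path cat_path last_cat /= c3' lastE andbT.
have eZ := mem_last z s1.
rewrite -andbA; apply/and3P; split.
- apply: (fpath_belast c1) => x xb xs; have xs' := mem_belast xb; apply: turn_twistD.
  + exact: sX1.
  + by apply: contraNneq vs1 => <-.
  + by apply: contraNneq ws1 => <-.
  + by apply: contraNneq vs1 => <-; rewrite inE xs orbT.
  + by apply: contraNneq ws1 => <-; rewrite inE xs orbT.
- rewrite /turn /= d'X //; first exact/eqP.
  + by apply: contraNneq vs1 => <-.
  + by apply: contraNneq ws1 => <-.
- rewrite /turn /= d'dw -vz /turn /= /t' switchD //.
  + exact: matching_neq.
  + by apply: contraTneq wX => <-; exact: dX.
  + rewrite tv (inj_eq perm_inj).
    have := mem_last w s2; rewrite inE -/L => /predU1P[->//|Ls].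
    by apply: contraNneq vs2 => ->.
  rewrite tw (inj_eq perm_inj); apply: contraNneq vs1 => ->; exact: eZ.
Qed.

End Twist.

(** Reversing an arc exchanges the roles of its two halves without changing the set of points.
    *)
Lemma half_set_flip d A B C : matching d -> half_set d (A ++ B ++ C) ->
  half_set d (A ++ map d (rev B) ++ C) /\
  points d (A ++ map d (rev B) ++ C) =i points d (A ++ B ++ C).
Proof.
move=> md [uX dX].
have mB x : (x \in map d (rev B)) = (d x \in B).
  by rewrite -[x in LHS](matchingK md) (mem_map perm_inj) mem_rev.
split; last by move=> x; rewrite !inE !mem_cat !mB matchingK // orbACA; do ?case: (_ \in _).
have [disA disC] : (forall x, x \in B -> x \notin A) /\ (forall x, x \in B -> x \notin C).
  move: uX; rewrite !cat_uniq => /and3P[_ /hasPn dis /and3P[_ /hasPn dis' _]].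
  split=> x xB; first by apply: dis; rewrite mem_cat xB.
  by apply: contraTN xB => /dis'.
split.
  move: uX; rewrite !cat_uniq (map_inj_uniq perm_inj) rev_uniq.
  case/and3P=> -> dis /and3P[-> dis' ->]; rewrite !andbT /=; apply/andP; split.
    apply: contra dis; rewrite !has_cat; case/orP=> [/hasP[x]|->]; last by rewrite orbT.
    rewrite mB => xB xA; have := dX x; rewrite !mem_cat xA xB orbT => /(_ isT).
    by [].
  apply: contra dis' => /hasP[x xC]; rewrite /= mB => xB.
  by have := dX x; rewrite !mem_cat xC xB !orbT => /(_ isT).
move=> x; rewrite !mem_cat !mB matchingK // => H.
have := dX x; have := dX (d x); rewrite matchingK // !mem_cat; move: H.
have := disA x; have := disC x; have := disA (d x); have := disC (d x).
case: (x \in A); case: (x \in B);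
  case: (x \in C); case: (d x \in A); case: (d x \in B); case: (d x \in C);
  move=> //= h1 h2 h3 h4 _ h5 h6;
  by [have := h1 isT | have := h2 isT | have := h3 isT | have := h4 isT
     | have := h5 isT | have := h6 isT].
Qed.

End Matchings.

Section Polygons.
Variable T : finType.
Implicit Types (d t p : {perm T}) (v w x y : T) (ss : seq (seq T)).

(** A family of disjoint polygons, given by the vertices that [turn d t] visits; off the
    family [d] and [t] coincide, so each frozen pair is a loop for both. *)
Record polygons d t ss : Prop := Polygons {
  polyd : matching d;
  polyt : matching t;
  poly_tr : half_set d (flatten ss);
  poly_cycle : {in ss, forall s, fcycle (turn d t) s};
  poly_frozen : {in [predC points d (flatten ss)], d =1 t} }.

Lemma poly_turn d t ss : polygons d t ss ->
  {in flatten ss, forall x, turn d t x \in flatten ss}.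
Proof.
move=> [_ _ _ cs _] x /flattenP[s ss_s xs]; apply/flattenP; exists s => //.
exact: mem_fcycle (cs s ss_s) x xs.
Qed.

Lemma points_d d (X : seq T) x : matching d -> x \in points d X -> d x \in points d X.
Proof. by move=> md; rewrite !inE matchingK // orbC. Qed.

(** Only the frozen pairs remain to be controlled: the new one is {v, w}, and [t] preserves
    the old ones because [d] does and both coincide there. *)
Lemma polygons_switch d t ss ss' v w : polygons d t ss ->
  v \in points d (flatten ss) -> w \in points d (flatten ss) -> v != w ->
  let d' := switch d v w in let t' := switch t v w in
  half_set d' (flatten ss') ->
  (forall x, (x \in points d' (flatten ss')) = [&& x \in points d (flatten ss), x != v & x != w])
    ->
  {in ss', forall s, fcycle (turn d' t') s} ->
  polygons d' t' ss'.
Proof.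
move=> [md mt tr cs fr] vS wS vw d' t' tr' sp cs'; split=> //; try exact: switch_matching.
move=> x; rewrite inE sp => xS.
have [->|xv] := eqVneq x v; first by rewrite /d' /t' !switchL.
have [->|xw] := eqVneq x w; first by rewrite /d' /t' !switchR.
move: xS; rewrite xv xw !andbT => xS.
(* t cannot send a point of the family to a frozen one *)
have nt z : z \in points d (flatten ss) -> x != t z.
  move=> zS; apply: contra xS => /eqP xE.
  have xz : t x = z by rewrite xE matchingK.
  apply/negPn/negP => xS; have dx : d x = z by rewrite fr.
  by move: xS; rewrite -[x](matchingK md) dx points_d.
rewrite /d' /t' !switchD ?nt //; first exact: fr.
  by apply: contraNneq xS => ->; exact: points_d.
by apply: contraNneq xS => ->; exact: points_d.
Qed.

(** A cut next to [v] produces an empty arc, which is not a polygon. *)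
Definition drop_nil ss := [seq s <- ss | ~~ nilp s].

Lemma flatten_drop_nil ss : flatten (drop_nil ss) = flatten ss.
Proof. by elim: ss => //= -[|x s] ss /= ->. Qed.

Lemma polygons_split d t v s1 s2 ss (w := d (last v s1))
  (d' := switch d v w) (t' := switch t v w) (ss' := drop_nil [:: s1, s2 & ss]) :
  polygons d t ((v :: s1 ++ s2) :: ss) ->
  polygons d' t' ss' /\
  (forall x, (x \in points d' (flatten ss')) =
     [&& x \in points d (flatten ((v :: s1 ++ s2) :: ss)), x != v & x != w]).
Proof.
move=> P; have [md mt tr cs fr] := P; set X := flatten _ in tr fr *.
have vX : v \in X by rewrite /X /= mem_head.
have yX : last v s1 \in X.
  have := mem_last v s1; rewrite /X /= !inE !mem_cat => /predU1P[->|->]; first by rewrite eqxx.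
  by rewrite orbT.
have uX := tr.1.
have sX : {subset v :: s1 ++ s2 <= X}.
  by move=> x; rewrite /X /= !inE !mem_cat => /orP[->//|->]; rewrite orbT.
have us : uniq (v :: s1 ++ s2) by move: uX;
  rewrite /X [flatten _]/= -cat_cons cat_uniq => /andP[].
have X'E : flatten ss' = s1 ++ s2 ++ flatten ss by rewrite /ss' flatten_drop_nil.
have [uX' X'X] : uniq (flatten ss') /\ flatten ss' =i [predD1 X & v].
  move: uX; rewrite /X X'E /= -catA => /andP[vn u]; split=> // x; rewrite !inE.
  by case: eqVneq => //= ->; rewrite (negbTE vn).
have [tr' sp'] := switch_points md tr vX yX uX' X'X.
split=> //; apply: (polygons_switch P) => //.
- by rewrite inE vX.
- by rewrite /w inE matchingK // yX orbT.
- by apply: contraTneq vX => ->; exact: tr.2.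
have vys s : s \in ss -> {subset s <= X} /\ v \notin s /\ last v s1 \notin s.
  move=> s_ss; have sXs x : x \in s -> x \in flatten ss by move=> xs; apply/flattenP; exists s.
  split; first by move=> x /sXs xs; rewrite /X /= inE mem_cat xs !orbT.
  move: uX; rewrite /X [flatten _]/= -cat_cons cat_uniq => /and3P[_ /hasPn dis _].
  split; apply/negP => /sXs /dis; first by rewrite /= mem_head.
  by have := mem_last v s1; rewrite /= !inE mem_cat => /orP[->|->] //; rewrite orbT.
have [c1 c2] := fcycle_switch_split md mt tr vX yX (poly_turn P) us sX erefl (cs _ (mem_head _
  _)).
move=> s; rewrite mem_filter => /andP[_]; rewrite !inE => /or3P[/eqP->|/eqP->|s_ss] //.
have [sXs [vs ys]] := vys _ s_ss.
apply: (fcycle_switch_other md mt tr vX yX (poly_turn P)) => //.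
by apply: cs; rewrite inE s_ss orbT.
Qed.

Lemma polygons_twist d t v s1 w s2 ss
  (d' := switch d v w) (t' := switch t v w) (ss' := (s1 ++ map d (rev (w :: s2))) :: ss) :
  polygons d t ((v :: s1 ++ w :: s2) :: ss) ->
  polygons d' t' ss' /\
  (forall x, (x \in points d' (flatten ss')) =
     [&& x \in points d (flatten ((v :: s1 ++ w :: s2) :: ss)), x != v & x != w]).
Proof.
move=> P; have [md mt tr cs fr] := P; set X := flatten _ in tr fr *.
have sX : {subset v :: s1 ++ w :: s2 <= X}.
  by move=> x xs; rewrite /X /= -cat_cons mem_cat xs.
have vX : v \in X by rewrite /X /= mem_head.
have wX : w \in X by apply: sX; rewrite inE mem_cat mem_head !orbT.
have uX := tr.1.
have us : uniq (v :: s1 ++ w :: s2) by move: uX;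
  rewrite /X [flatten _]/= -cat_cons cat_uniq => /andP[].
have vw : v != w by move: us => /= /andP[]; rewrite mem_cat inE !negb_or => /and3P[].
have := tr; have -> : X = (v :: s1) ++ (w :: s2) ++ flatten ss by rewrite /X /= -catA.
move=> trc; have [trf spf] := half_set_flip md trc.
set Xf := (v :: s1) ++ _ in trf spf.
have vXf : v \in Xf by rewrite /Xf mem_head.
have ywX : d w \in Xf by rewrite /Xf !mem_cat (mem_map perm_inj) mem_rev mem_head orbT.
have X'E : flatten ss' = s1 ++ map d (rev (w :: s2)) ++ flatten ss by rewrite /ss' /= -catA.
have [uX' X'X] : uniq (flatten ss') /\ flatten ss' =i [predD1 Xf & v].
  move: trf.1; rewrite /Xf X'E [_ ++ _]/= [uniq (_ :: _)]/= => /andP[vn u]; split=> // x.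
  by rewrite !inE; case: eqVneq => //= ->; rewrite (negbTE vn).
have := switch_points md trf vXf ywX uX' X'X; rewrite matchingK // => -[tr' sp'].
have sp2 x : (x \in points d' (flatten ss')) = [&& x \in points d X, x != v & x != w].
  by rewrite sp' spf /X /= -catA.
split=> //.
  apply: (polygons_switch P) => //.
  - by rewrite inE vX.
  - by rewrite inE wX.
have vys s : s \in ss -> {subset s <= X} /\ v \notin s /\ w \notin s.
  move=> s_ss; have sXs x : x \in s -> x \in flatten ss by move=> xs; apply/flattenP; exists s.
  split; first by move=> x /sXs xs; rewrite /X /= inE mem_cat xs !orbT.
  move: uX; rewrite /X [flatten _]/= -cat_cons cat_uniq => /and3P[_ /hasPn dis _].
  split; apply/negP => /sXs /dis; first by rewrite /= mem_head.
  by rewrite /= inE mem_cat mem_head !orbT.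
move=> s; rewrite !inE => /predU1P[->|s_ss].
  exact: (fcycle_twist md mt tr vX wX vw us sX (cs _ (mem_head _ _))).
have [sXs [vs ys]] := vys _ s_ss.
apply: (fcycle_twist_other md mt tr vX wX sXs) => //.
by apply: cs; rewrite inE s_ss orbT.
by move=> x; rewrite sp2 /X /= -catA.
Qed.

Lemma fcycle_reflect d t s : matching d -> matching t ->
  fcycle (turn d t) s -> fcycle (turn d t) (map d (rev s)).
Proof.
move=> md mt cs; rewrite cycle_map rev_cycle.
apply: sub_cycle (cs) => x z /= /eqP <-.
by rewrite /turn /= matchingK // matchingK.
Qed.

(** A polygon may be read backwards, through its other half; for a merge this allows [w] to be
    taken in the half opposite to that of [v]. *)
Lemma polygons_reflect d t ss1 s ss2 : polygons d t (ss1 ++ s :: ss2) ->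
  polygons d t (ss1 ++ map d (rev s) :: ss2) /\
  points d (flatten (ss1 ++ map d (rev s) :: ss2)) =i points d (flatten (ss1 ++ s :: ss2)).
Proof.
move=> [md mt tr cs fr]; move: tr; rewrite !flatten_cat /= => tr.
have [tr' sp'] := half_set_flip md tr; split=> //; split=> //.
- by rewrite flatten_cat.
- move=> s'; rewrite mem_cat inE => /or3P[s's|/eqP->|s's].
  + by apply: cs; rewrite mem_cat s's.
  + by apply: fcycle_reflect => //; apply: cs; rewrite mem_cat mem_head orbT.
  + by apply: cs; rewrite mem_cat inE s's !orbT.
by move=> x; rewrite inE flatten_cat sp' => xS; apply: fr; rewrite inE flatten_cat.
Qed.

Lemma polygons_merge d t v s ss y (w := d y)
  (d' := switch d v w) (t' := switch t v w) :
  polygons d t ((v :: s) :: ss) -> y \in flatten ss ->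
  exists ss',
  [/\ polygons d' t' ss', (size ss' <= size ss)%N,
   size (flatten ss') = (size s + size (flatten ss))%N &
  forall x, (x \in points d' (flatten ss')) =
     [&& x \in points d (flatten ((v :: s) :: ss)), x != v & x != w]].
Proof.
move=> + /flattenP[s0 s0s ys0]; case/splitPr: s0s => r1 r2; case/splitPr: ys0 => b1 b2 P.
have [md mt tr cs fr] := P; set X := flatten _ in tr fr *.
have XE : X = v :: s ++ flatten (r1 ++ (b1 ++ y :: b2) :: r2) by [].
have vX : v \in X by rewrite XE mem_head.
have yX : y \in X.
  by rewrite XE flatten_cat /= !(inE, mem_cat) eqxx !orbT.
set s2 := b2 ++ rcons b1 y.
have s2E : perm_eq s2 (b1 ++ y :: b2) by rewrite /s2 perm_catC cat_rcons.
have ys2 : y = last v s2 by rewrite /s2 last_cat last_rcons.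
have s2n : s2 != [::] by rewrite /s2; case: (b2) => //; case: (b1).
have cs2 : fcycle (turn d t) s2.
  by rewrite /s2 cycle_catC cat_rcons; apply: cs; rewrite inE mem_cat mem_head !orbT.
pose ss' := (s ++ s2) :: r1 ++ r2.
have fE : flatten ss' = (s ++ s2) ++ flatten r1 ++ flatten r2 by rewrite /ss' /= flatten_cat.
have pX : perm_eq (v :: flatten ss') X.
  rewrite XE perm_cons fE flatten_cat [flatten (_ :: r2)]/= -catA perm_cat2l.
  by rewrite perm_sym perm_catCA perm_cat2r perm_sym.
have vf : uniq (v :: flatten ss') by rewrite (perm_uniq pX); exact: tr.1.
have X'X : flatten ss' =i [predD1 X & v].
  move=> x; rewrite [RHS]inE /= -(perm_mem pX) inE.
  by case: eqVneq => //= ->; move: vf => /= /andP[/negbTE->].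
have uX' : uniq (flatten ss') by case/andP: vf.
have [tr' sp'] := switch_points md tr vX yX uX' X'X.
have sX : {subset v :: s ++ s2 <= X}.
  by move=> x xs; rewrite -(perm_mem pX) fE -cat_cons mem_cat xs.
have us : uniq (v :: s ++ s2).
  by move: vf; rewrite fE -cat_cons cat_uniq => /andP[].
exists ss'; split=> //.
- apply: (polygons_switch P) => //.
  + by rewrite inE vX.
  + by rewrite /w inE matchingK // yX orbT.
  + by apply: contraTneq vX => ->; exact: tr.2.
  move=> s'; rewrite inE => /predU1P[->|s'r].
    exact: (fcycle_switch_merge md mt tr vX yX (poly_turn P) us sX s2n ys2 (cs _ (mem_head _ _))).
  have s'X x : x \in s' -> x \in flatten (r1 ++ r2) by move=> xs; apply/flattenP; exists s'.
  have dis x : x \in s' -> x \notin v :: s ++ s2.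
    move/s'X => xr; move: vf; rewrite fE -flatten_cat -cat_cons cat_uniq.
    by case/and3P => _ /hasPn /(_ x xr).
  apply: (fcycle_switch_other md mt tr vX yX (poly_turn P)).
  + by move=> x /s'X xs; rewrite -(perm_mem pX) inE /= mem_cat xs !orbT.
  + by apply/negP => /dis; rewrite mem_head.
  + by apply/negP => /dis; rewrite inE mem_cat ys2 /s2 mem_cat last_cat last_rcons mem_rcons
      mem_head !orbT.
  apply: cs; move: s'r; rewrite !(inE, mem_cat) => /orP[]->; by rewrite !orbT.
- by rewrite /ss' /= !size_cat /= addnS.
by apply: succn_inj; rewrite -[LHS]/(size (v :: flatten ss')) (perm_size pX) XE /= size_cat.
Qed.

Lemma polygons_merge_points d t v s ss w
  (d' := switch d v w) (t' := switch t v w) :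
  polygons d t ((v :: s) :: ss) -> w \in points d (flatten ss) ->
  exists ss',
  [/\ polygons d' t' ss', (size ss' <= size ss)%N,
   size (flatten ss') = (size s + size (flatten ss))%N &
  forall x, (x \in points d' (flatten ss')) =
     [&& x \in points d (flatten ((v :: s) :: ss)), x != v & x != w]].
Proof.
move=> P; have md := polyd P.
have [dwf _|/negbTE dwf] := boolP (d w \in flatten ss).
  by have := polygons_merge P dwf; rewrite matchingK.
rewrite inE dwf orbF => /flattenP[s0 s0s ws0].
case/splitPr: s0s P {dwf} => r1 r2 P.
have [P' sp'] := @polygons_reflect d t ((v :: s) :: r1) s0 r2 P.
have wf' : d w \in flatten (r1 ++ map d (rev s0) :: r2).
  by rewrite flatten_cat /= !mem_cat (mem_map perm_inj) mem_rev ws0 orbT.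
have := polygons_merge P' wf'; rewrite matchingK // => -[ss' [Q sz szf spf]].
exists ss'; split=> //.
- by move: sz; rewrite !size_cat.
- by rewrite szf !flatten_cat /= !size_cat size_map size_rev.
by move=> x; rewrite spf sp'.
Qed.

End Polygons.

(** * The two leading coefficients of the sum over matchings *)

Section Leading.
Variables (T : finType) (R : fieldType) (s : R) (M M' : nat -> R).
Implicit Types (d t p : {perm T}) (v w x y : T) (ss : seq (seq T)).
Let Mt i := if i == 0%N then s ^+ 2 else M i.
Hypotheses (s0 : s != 0).
Hypothesis M0 : M 0 = 1.
Hypothesis MS : forall n, M n.+1 = \sum_(i < n.+1) Mt i * M (n - i)%N.
Hypothesis M'0 : M' 0 = 0.
Hypothesis M'S : forall n, M' n.+1 =
  \sum_(i < n.+1) (M' i * M (n - i)%N + Mt i * M' (n - i)%N) + n%:R * M n.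

Fixpoint prodM ss := if ss is q :: ss' then M (size q) * prodM ss' else 1.

(** The derivative of the product [prodM] along [M']. *)
Fixpoint prodM' ss := if ss is q :: ss' then
  M' (size q) * prodM ss' + M (size q) * prodM' ss' else 0.

Lemma prodM_drop_nil ss : prodM (drop_nil ss) = prodM ss.
Proof. by elim: ss => //= -[|x q] ss /= ->; rewrite ?M0 ?mul1r. Qed.

Lemma prodM'_drop_nil ss : prodM' (drop_nil ss) = prodM' ss.
Proof.
elim: ss => //= -[|x q] ss /= IH; last by rewrite IH prodM_drop_nil.
by rewrite IH M0 M'0 mul0r add0r mul1r.
Qed.

Lemma matching_sum_ext D (S S' : {pred T}) d t : S =i S' ->
  matching_sum s D S d t = matching_sum s D S' d t.
Proof.
move=> SS; rewrite /matching_sum; apply: eq_bigl => p.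
by congr [&& _, _ & _]; apply: eq_forallb => x; rewrite SS.
Qed.

Lemma polygons_drop_nil d t ss : polygons d t ss -> polygons d t (drop_nil ss).
Proof.
move=> [md mt tr cs fr]; split; rewrite ?flatten_drop_nil // => q.
by rewrite mem_filter => /andP[_ /cs].
Qed.

(** The largest value of [#(d p) + #(t p)] for a family [ss] with [e] frozen points, by the
    bound on the Euler characteristic. *)
Definition top_degree e ss := (#|T| + e + (size ss).*2)%N.

(** The second coefficient sits two degrees below the first; the form [D.+2 = _] avoids a
    truncated subtraction. *)
Definition leading d t e ss :=
  let Z D := matching_sum s D (points d (flatten ss)) d t in
  [/\ forall D, (top_degree e ss < D)%N -> Z D = 0,
      forall D, D = top_degree e ss -> Z D = s ^+ e * prodM ss
    & forall D, D.+2 = top_degree e ss -> Z D = s ^+ e * prodM' ss].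

Lemma porbits1 : #|porbits (1 : {perm T})%g| = #|T|.
Proof.
rewrite /porbits card_imset // => x z; move/eqP; rewrite eq_porbit_mem.
by rewrite porbit.unlock => /imsetP[g]; rewrite cycle1 inE => /eqP -> ->; rewrite /aperm perm1.
Qed.

(** Without polygons the only matching is [d = t], and both products are the identity. *)
Lemma leading0 d t : polygons d t [::] -> leading d t #|T| [::].
Proof.
move=> [md mt _ _ fr].
have dt : t = d by apply/permP => x; apply/esym/fr.
have dd : (d * d = 1)%g by apply/permP => x; rewrite permM perm1 matchingK.
have E D : matching_sum s D (points d (flatten [::])) d t = (D == #|T| + #|T|)%N%:R * s ^+ #|T|.
  rewrite /matching_sum (eq_bigl (fun p => (p == d) && (D == #|T| + #|T|)%N)); last first.
    move=> p; rewrite dt; apply/idP/idP.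
      case/and3P=> mp /forallP ag /eqP <-.
      have -> : p = d by apply/permP => x; apply/eqP; have := ag x.
      by rewrite dd porbits1 !eqxx.
    case/andP=> /eqP-> /eqP->; rewrite md dd porbits1 eqxx andbT.
    by apply/forallP => x; rewrite eqxx orbT.
  case: eqP => _; rewrite ?mul0r ?mul1r.
    by rewrite (big_pred1 d) ?dd ?porbits1 // => p; rewrite andbT.
  by rewrite big_pred0 // => p; rewrite andbF.
rewrite /leading /top_degree /= addn0 mulr1.
split=> [D lD|D ->|D DE]; rewrite E.
- by rewrite gtn_eqF // mul0r.
- by rewrite eqxx mul1r.
- by rewrite (_ : (_ == _) = false) ?mul0r ?mulr0 // -DE; lia.
Qed.

Section Step.
Variables (d t : {perm T}) (v : T) (q : seq T) (ss : seq (seq T)) (e : nat).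
Hypotheses (P : polygons d t ((v :: q) :: ss)) (ne : [::] \notin ss).
Hypothesis he : (e + (size (flatten ((v :: q) :: ss))).*2 = #|T|)%N.
Hypothesis IH : forall d' t' ss', polygons d' t' ss' -> [::] \notin ss' ->
  size (flatten ss') = size (q ++ flatten ss) -> leading d' t' e.+2 ss'.

Let U := points d (flatten ((v :: q) :: ss)).
Let rest w : {pred T} := [pred x | [&& x \in U, x != v & x != w]].

(** The contribution of the partner [w] of [v] in [matching_sum_rec]. *)
Definition partner_term D w := s ^- ((d v != w).*2) *
  matching_sum s (D + (d v != w).*2 + (t v != w).*2) (rest w) (switch d v w) (switch t v w).

(** A cut keeps the degree maximal: each non-empty arc is a new polygon, while each empty arc
    accounts for [d v = w] or [t v = w]. The factor [s ^+ 2] of an empty first arc is the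
    value at 0 of [Mt]. *)
Lemma split_partner_term i (w := d (nth v (v :: q) i)) : (i <= size q)%N ->
  let top0 := top_degree e ((v :: q) :: ss) in
  [/\ forall D, (top0 < D)%N -> partner_term D w = 0,
     forall D, D = top0 -> partner_term D w = s ^+ e * (Mt i * M (size q - i)%N * prodM ss)
   & forall D, D.+2 = top0 -> partner_term D w = s ^+ e *
       ((M' i * M (size q - i)%N + Mt i * M' (size q - i)%N) * prodM ss
        + Mt i * M (size q - i)%N * prodM' ss)].
Proof.
move=> iq top0.
have yE : nth v (v :: q) i = last v (take i q).
  by rewrite (last_nth v) size_takel // -[LHS](@nth_take i.+1) // /= take_cons.
have Q := P; move: (Q); rewrite -{1}(cat_take_drop i q) => /polygons_split.
rewrite cat_take_drop -yE -/w; set s1 := take i q; set s2 := drop i q.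
set ss' := drop_nil [:: s1, s2 & ss]; cbv zeta => -[P' sp'].
have qE : q = s1 ++ s2 by rewrite cat_take_drop.
have [md mt [uX _] cs fr] := Q.
have uq : uniq (v :: q) by move: uX; rewrite [flatten _]/= -cat_cons cat_uniq => /andP[].
have b1 : (d v != w) = ~~ nilp s1.
  rewrite /w (inj_eq perm_inj) yE -/s1; move: uq; rewrite qE /=.
  case: (s1) => [|x p] /=; first by rewrite eqxx.
  rewrite inE negb_or mem_cat negb_or -!andbA => /and3P[vx vp _].
  have := mem_last x p; rewrite inE => /predU1P[->|h]; first exact: vx.
  by apply/eqP => vE; move: vp; rewrite vE h.
have b2 : (t v != w) = ~~ nilp s2.
  have := cs _ (mem_head _ _); rewrite /= rcons_path /turn /= => /andP[_ /eqP <-].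
  rewrite matchingK // /w (inj_eq perm_inj) yE -/s1; move: uq; rewrite qE /=.
  rewrite last_cat; case: (s2) => [|x p] /=; first by rewrite eqxx.
  move=> uq; apply/eqP => lE; move: uq lE;
    rewrite mem_cat negb_or cat_uniq /= negb_or => /and3P[/andP[_ vp] _ /and3P[/andP[xs hs] xp
      _]] lE.
  have l2 := mem_last x p; have := mem_last v s1; rewrite -lE inE => /predU1P[lv|l1].
    by move: vp; rewrite -lv l2.
  move: l2; rewrite inE => /predU1P[lx|lp]; first by move: xs; rewrite -lx l1.
  by move/hasP: hs; apply; exists (last x p).
have ssE : drop_nil ss = ss.
  apply/all_filterP/allP => x xs; apply: contraNN ne; by case: x xs.
have szE : size ss' = (~~ nilp s1 + ~~ nilp s2 + size ss)%N.
  rewrite /ss' /drop_nil /= -/(drop_nil ss) ssE; by case: (nilp s1); case: (nilp s2);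
    exact: erefl.
have neE : [::] \notin ss' by rewrite mem_filter.
have fE : flatten ss' = q ++ flatten ss by rewrite /ss' flatten_drop_nil [in RHS]qE /= -catA.
have topE : top_degree e.+2 ss' = (top0 + (~~ nilp s1).*2 + (~~ nilp s2).*2)%N.
  by rewrite /top0 /top_degree szE /=; clear; lia.
have termE D : partner_term D w = s ^- ((~~ nilp s1).*2) *
  matching_sum s (D + (~~ nilp s1).*2 + (~~ nilp s2).*2) (points (switch d v w) (flatten ss'))
    (switch d v w) (switch t v w).
  by rewrite /partner_term b1 b2; congr (_ * _); apply: matching_sum_ext => x; rewrite sp'.
(* two more points are frozen after the switch, whence the exponent e + 2 *)
have Me : s ^- ((~~ nilp s1).*2) * s ^+ e.+2 = s ^+ e * (if nilp s1 then s ^+ 2 else 1).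
  by case: nilp; rewrite -addn2 exprD /= ?expr0 ?invr1 ?mul1r // mulrCA mulVf ?mulr1 // expf_neq0.
have MtE : (if nilp s1 then s ^+ 2 else 1) * M (size s1) = Mt i.
  rewrite /Mt /nilp size_takel //; case: eqP => [->|_]; by rewrite ?M0 ?mulr1 ?mul1r.
have M'tE : (if nilp s1 then s ^+ 2 else 1) * M' (size s1) = M' i.
  rewrite /nilp size_takel //; case: eqP => [->|_]; by rewrite ?M'0 ?mulr0 ?mul1r.
have [L0 L1 L2] := IH P' neE (f_equal size fE).
split=> D DE; rewrite termE.
- by rewrite L0 ?mulr0 // topE !ltn_add2r.
- rewrite L1 ?topE ?DE // [LHS]mulrA Me -[LHS]mulrA; congr (_ * _).
  by rewrite /ss' prodM_drop_nil /= -MtE size_drop !mulrA.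
- rewrite L2 ?topE -?DE ?addSn // [LHS]mulrA Me -[LHS]mulrA; congr (_ * _).
  by rewrite /ss' prodM'_drop_nil /= -MtE -M'tE size_drop !(mulrDr, mulrDl) !mulrA !addrA.
Qed.

Lemma head_uniq : uniq (v :: q ++ flatten ss).
Proof. by have [_ _ [uX _] _ _] := P; move: uX; rewrite /=. Qed.

(** Both cycle counts grow by 2 under the switch, unless [w] is adjacent to [v]. *)
Lemma far_partner_term w ss' D : d v != w -> t v != w -> [::] \notin ss' ->
  polygons (switch d v w) (switch t v w) ss' ->
  (forall x, (x \in points (switch d v w) (flatten ss')) = [&& x \in U, x != v & x != w]) ->
  size (flatten ss') = (size q + size (flatten ss))%N ->
  ((top_degree e.+2 ss' < D + 4)%N -> partner_term D w = 0) /\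
  ((D + 4)%N = top_degree e.+2 ss' -> partner_term D w = s ^+ e * prodM ss').
Proof.
move=> dvw tvw ne' P' sp' sz.
have termE : partner_term D w = s ^- 2 * matching_sum s (D + 4) (points (switch d v w) (flatten
  ss')) (switch d v w) (switch t v w).
  rewrite /partner_term dvw tvw -addnA; congr (_ * _); apply: matching_sum_ext => x;
    by rewrite sp'.
rewrite -size_cat in sz.
have [L0 L1 _] := IH P' ne' sz; split=> DE; rewrite termE.
  by rewrite L0 ?mulr0.
by rewrite L1 // mulrA -[e.+2]addn2 exprD mulrCA mulVf ?expf_neq0 // mulr1.
Qed.

(** A twist removes one vertex pair without creating a polygon, so it loses 2 in degree: it
    contributes the leading coefficient of the remaining polygon to the second coefficient. *)
Lemma twist_partner_term w : w \in q -> let top0 := top_degree e ((v :: q) :: ss) in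
  (forall D, (top0 <= D)%N -> partner_term D w = 0) /\
  (forall D, D.+2 = top0 -> partner_term D w = s ^+ e * (M (size q) * prodM ss)).
Proof.
move=> wq top0; have [md mt tr cs fr] := P.
have vX : v \in flatten ((v :: q) :: ss) by rewrite mem_head.
have wX : w \in flatten ((v :: q) :: ss) by rewrite /= inE mem_cat wq orbT.
have dvw : d v != w by apply: contraTneq wX => <-; exact: tr.2.
have tvw : t v != w.
  apply: contraTneq wX => <-; have := cs _ (mem_head _ _).
  rewrite /= rcons_path /turn /= => /andP[_ /eqP {1}<-]; rewrite matchingK //; apply: tr.2.
  have := mem_last v q; rewrite /= !inE mem_cat => /orP[->|->] //; by rewrite orbT.
have [s1 [s2 qE]] : exists s1 s2, q = s1 ++ w :: s2.
  by case/splitPr: wq => s1 s2; exists s1, s2.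
have := P; rewrite {1}qE => /polygons_twist[]; cbv zeta; rewrite -qE.
set ss' := _ :: ss => P' sp'.
have ne' : [::] \notin ss'.
  by rewrite inE negb_or ne andbT eq_sym -size_eq0 size_cat size_map size_rev addnS.
have sz : size (flatten ss') = (size q + size (flatten ss))%N.
  by rewrite /= qE !size_cat size_map size_rev.
have topE : top_degree e.+2 ss' = top0.+2 by rewrite /top0 /top_degree /=; clear; lia.
have F D := far_partner_term D dvw tvw ne' P' sp' sz.
split=> D DE; first by apply: (F D).1; rewrite topE; move: DE; clear; lia.
rewrite (F D).2 ?topE -?DE; last by clear; lia.
by rewrite /ss' /= qE !size_cat size_map size_rev.
Qed.

(** A merge loses one polygon, hence 4 in degree, and is invisible in the two leading
    coefficients. *)
Lemma merge_partner_term w D : w \in points d (flatten ss) ->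
  (top_degree e ((v :: q) :: ss) <= D.+2)%N -> partner_term D w = 0.
Proof.
move=> wS DE; have [md mt tr cs fr] := P.
have /= /andP[_ ] := head_uniq; rewrite cat_uniq => /and3P[_ /hasPn dis _].
have vX : v \in flatten ((v :: q) :: ss) by rewrite mem_head.
have turnS x : x \in flatten ss -> turn d t x \in flatten ss.
  case/flattenP=> s' s's xs; apply/flattenP; exists s' => //.
  by apply: mem_fcycle xs; apply: cs; rewrite inE s's orbT.
have fX x : x \in flatten ss -> x \in flatten ((v :: q) :: ss).
  by move=> xs; rewrite /= inE mem_cat xs !orbT.
have vn : v \notin flatten ss.
  by have /= /andP[] := head_uniq; rewrite mem_cat negb_or => /andP[].
have dvw : d v != w.
  apply: contraTneq wS => <-; rewrite inE negb_or matchingK // vn andbT.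
  by apply: contra (tr.2 _ vX) => /fX.
have tvw : t v != w.
  have lX : last v q \in v :: q by exact: mem_last.
  have := cs _ (mem_head _ _); rewrite /= rcons_path /turn /= => /andP[_ /eqP {1}<-].
  rewrite matchingK //; apply: contraTneq wS => <-; rewrite inE negb_or matchingK //.
  have lX' : last v q \in flatten ((v :: q) :: ss).
    by move: lX; rewrite /= !inE mem_cat => /orP[->|->] //; rewrite orbT.
  apply/andP; split; first by apply: contra (tr.2 _ lX') => /fX.
  move: lX; rewrite inE => /predU1P[->//|lq]; by apply/negP => /dis; rewrite /= lq.
have [ss' [P' sz szf sp']] := polygons_merge_points P wS.
have neE : [::] \notin drop_nil ss' by rewrite mem_filter.
apply: (far_partner_term D dvw tvw neE (polygons_drop_nil P') _ _).1.
- by move=> x; rewrite flatten_drop_nil sp'.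
- by rewrite flatten_drop_nil.
have : (size (drop_nil ss') <= size ss)%N by rewrite (leq_trans _ sz) // size_filter count_size.
by move: DE; rewrite /top_degree /=; clear; lia.
Qed.

Lemma matching_sum_partner D : matching_sum s D U d t =
  \sum_(i < (size q).+1) partner_term D (d (nth v (v :: q) i)) +
  (\sum_(w <- q) partner_term D w + \sum_(w <- flatten ss ++ map d (flatten ss)) partner_term D
    w).
Proof.
have [md mt [uX dX] cs fr] := P.
have vU : v \in U by rewrite inE /= mem_head.
rewrite (@matching_sum_rec _ _ _ D rest _ _ v) //; last first.
  by move=> x xU; exact: points_d.
have -> : \sum_(i < (size q).+1) partner_term D (d (nth v (v :: q) i)) =
   \sum_(w <- map d (v :: q)) partner_term D w.
  by rewrite big_map (big_nth v) big_mkord.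
rewrite -!big_cat /=.
have uL : uniq (map d (v :: q) ++ q ++ flatten ss ++ map d (flatten ss)).
  have : uniq ((v :: q ++ flatten ss) ++ map d (v :: q ++ flatten ss)).
    rewrite cat_uniq (map_inj_uniq perm_inj) head_uniq andbT.
    by apply/hasPn => _ /mapP[x xX ->]; apply: dX.
  rewrite cat_cons cons_uniq => /andP[_].
  have pe : perm_eq (map d (v :: q) ++ q ++ flatten ss ++ map d (flatten ss))
     ((q ++ flatten ss) ++ map d (v :: q ++ flatten ss)).
    rewrite -[_ :: (q ++ _)]cat_cons map_cat [q ++ flatten ss ++ _]catA.
    by rewrite perm_catCA.
  by rewrite (perm_uniq pe).
rewrite (big_uniq _ uL); apply: eq_bigl => w.
have mE (A : seq T) : (w \in map d A) = (d w \in A).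
  by rewrite -[w in LHS](matchingK md) (mem_map perm_inj).
rewrite !mem_cat !mE [w \in U]inE /= !inE !mem_cat.
have [->|wv] := eqVneq w v; last first.
  rewrite /= andbT; case: (d w == v); case: (d w \in q); case: (w \in q);
  by case: (w \in flatten ss); case: (d w \in flatten ss).
have := head_uniq; rewrite cons_uniq mem_cat negb_or => /andP[/andP[/negbTE-> /negbTE->] _].
have := dX v; rewrite /= !inE eqxx => /(_ isT); rewrite mem_cat !negb_or.
by case/and3P=> /negbTE-> /negbTE-> /negbTE->.
Qed.

(** Summing [split_partner_term] over the cuts gives the convolutions of the recursions of [M]
    and [M'], and the [size q] twists give the term [n M_n]. *)
Lemma leading_step : leading d t e ((v :: q) :: ss).
Proof.
have merge0 D : (top_degree e ((v :: q) :: ss) <= D.+2)%N ->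
    \sum_(w <- flatten ss ++ map d (flatten ss)) partner_term D w = 0.
  move=> DE; rewrite big_seq big1 // => w wS; apply: merge_partner_term DE.
  move: wS; rewrite mem_cat inE; case/orP=> [->//|/mapP[x xf ->]].
  by rewrite matchingK ?xf ?orbT // (polyd P).
rewrite /leading -/U; split=> D DE; rewrite matching_sum_partner merge0 ?addr0 //; try lia.
- rewrite big1 ?add0r => [|i _]; last first.
    by have [+ _ _] := @split_partner_term i (ltn_ord i); apply.
  rewrite big_seq big1 // => w wq; apply: (twist_partner_term wq).1; exact: ltnW.
- rewrite [X in _ + X]big_seq [X in _ + X]big1 ?addr0 => [|w wq]; last first.
    by apply: (twist_partner_term wq).1; rewrite DE.
  rewrite (eq_bigr (fun i : 'I_(size q).+1 =>
     s ^+ e * (Mt i * M (size q - i)%N * prodM ss))) => [|i _]; last first.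
    by have [_ + _] := @split_partner_term i (ltn_ord i); apply.
  by rewrite -big_distrr -big_distrl /= MS.
rewrite (eq_bigr (fun i : 'I_(size q).+1 =>
   s ^+ e * ((M' i * M (size q - i)%N + Mt i * M' (size q - i)%N) * prodM ss
        + Mt i * M (size q - i)%N * prodM' ss))) => [|i _]; last first.
  by have [_ _ +] := @split_partner_term i (ltn_ord i); apply.
have -> : \sum_(w <- q) partner_term D w = \sum_(w <- q) s ^+ e * (M (size q) * prodM ss).
  by rewrite big_seq [RHS]big_seq; apply: eq_bigr => w wq; apply: (twist_partner_term wq).2.
rewrite big_const_seq count_predT iter_addr_0.
rewrite -big_distrr big_split /= -!big_distrl /= -MS M'S -[_ *+ _]mulr_natl.
ring.
Qed.

End Step.

Lemma matching_sum_leading d t ss e : polygons d t ss -> [::] \notin ss ->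
  (e + (size (flatten ss)).*2 = #|T|)%N -> leading d t e ss.
Proof.
move: {2}(size _) (erefl (size (flatten ss))) => m.
elim: m d t ss e => [|m IHm] d t [|[|v q] ss] e sz P ne he //.
  by move: he; rewrite addn0 => ->; apply: leading0.
have ne' : [::] \notin ss by move: ne; rewrite inE negb_or => /andP[].
apply: (leading_step P ne' he).
move=> d' t' ss' P' ne'' sz'; apply: IHm => //.
  by rewrite sz'; move: sz => /= [].
by move: he; rewrite sz' /=; lia.
Qed.

End Leading.

(** * Non-crossing partitions *)

(** A pointwise form of [partition], convenient for blocks that are modified one by one. *)
Lemma partition_blocksP (T : finType) (p : {set {set T}}) (S : {set T}) :
  reflect [/\ forall B, B \in p -> B != set0 /\ B \subset S,
              forall x, x \in S -> exists2 B, B \in p & x \in B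
            & forall B B' x, B \in p -> B' \in p -> x \in B -> x \in B' -> B = B']
    (partition p S).
Proof.
apply: (iffP and3P) => [[/eqP cov tr n0]|[sub ex un]].
  split.
  - move=> B pB; split; first by apply: contraNneq n0 => <-.
    by rewrite -cov; apply: bigcup_sup pB.
  - by rewrite -cov => x /bigcupP[B pB xB]; exists B.
  move=> B B' x pB pB' xB xB'.
  by rewrite -(def_pblock tr pB xB) -(def_pblock tr pB' xB').
split.
- apply/eqP/setP => x; apply/bigcupP/idP => [[B pB xB]|/ex[B pB xB]]; last by exists B.
  exact: (subsetP (sub B pB).2).
- apply/trivIsetP => B B' pB pB' BB'; rewrite -setI_eq0; apply: contraNT BB' => /set0Pn[x].
  by rewrite inE => /andP[xB xB']; apply/eqP; apply: un xB xB'.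
by apply/negP => /sub[]; rewrite eqxx.
Qed.

Section Noncrossing.
Variable N : nat.
Notation T := 'I_N.
Implicit Types (S L R B C : {set T}) (p q : {set {set T}}) (a k x y : T).

Lemma noncrossingP p :
  reflect (forall B B' i j k l, B \in p -> B' \in p -> i \in B -> j \in B' ->
    k \in B -> l \in B' -> (i < j < k)%N -> (k < l)%N -> B = B') (noncrossing p).
Proof.
apply: (iffP forall_inP) => [H B B' i j k l pB pB' iB jB' kB lB' /andP[ij jk] kl|H B pB].
  have /forall_inP/(_ B' pB')/implyP := H B pB => h; apply/eqP/h.
  apply/exists_inP; exists i => //; apply/exists_inP; exists j => //.
  apply/exists_inP; exists k => //; apply/exists_inP; exists l => //.
  by rewrite ij jk kl.
apply/forall_inP => B' pB'; apply/implyP => /exists_inP[i iB /exists_inP[j jB'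
  /exists_inP[k kB /exists_inP[l lB' /andP[ijk kl]]]]].
by apply/eqP; apply: (H B B' i j k l).
Qed.

Definition NCon S := [set p : {set {set T}} | partition p S && noncrossing p].

Section Peel.
Variables (S L R : {set T}) (a k : T).
Hypotheses (aS : a \notin L :|: R) (SE : S = a |: (L :|: R)).
Hypotheses (aL : forall x, x \in L :|: R -> (a < x)%N).
Hypotheses (LR : forall x y, x \in L -> y \in R -> (x < y)%N).
Hypotheses (kR : k \in R) (kmin : forall y, y \in R -> (k <= y)%N).

(** [k] is the successor of [a] in the block of [a]: that block avoids the points [L] in
    between. *)
Definition follows p := [exists B in p, [&& a \in B, k \in B & [disjoint B & L]]].

Definition attach q := [set if k \in B then a |: B else B | B : {set T} in q].
Definition detach p := [set B :\ a | B : {set T} in p].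

Definition split_at q := [forall B in q, (B \subset L) || (B \subset R)].

Let aR x : x \in R -> (a < x)%N. Proof. by move=> xR; apply: aL; rewrite inE xR orbT. Qed.
Let ak : a != k. Proof. by apply: contraTneq (aR kR) => ->; rewrite ltnn. Qed.

(** A crossing with [a] involved must be of the form a < j < m < l with [m] in the block of
    [k]; then [j] and [l] lie in [R], so it was already a crossing with [k] in place of [a].
    *)
Lemma attach_NC q : q \in NCon (L :|: R) -> split_at q ->
  (attach q \in NCon S) && follows (attach q).
Proof.
rewrite inE => /andP[/partition_blocksP[sub ex un] /noncrossingP nc] /forall_inP sp.
have naB B : B \in q -> a \notin B.
  by move=> qB; apply: contra aS => aB; apply: (subsetP (sub B qB).2).
have kRB B : B \in q -> k \in B -> B \subset R.
  move=> qB kB; case/orP: (sp B qB) => // /subsetP/(_ k kB) kL.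
  by have := LR kL kR; rewrite ltnn.
apply/andP; split; last first.
  have [B qB kB] : exists2 B, B \in q & k \in B by apply: ex; rewrite inE kR orbT.
  apply/exists_inP; exists (a |: B).
    by apply/imsetP; exists B => //; rewrite kB.
  rewrite !inE eqxx kB orbT /=; apply/pred0P => x /=; apply/negP => /andP[].
  rewrite !inE => /predU1P[->|xB] xL; first by move: aS; rewrite inE xL.
  by have := LR xL (subsetP (kRB B qB kB) x xB); rewrite ltnn.
rewrite inE; apply/andP; split.
  apply/partition_blocksP; split.
  - move=> _ /imsetP[B qB ->]; have [B0 BS] := sub B qB; rewrite SE.
    case: ifP => _; last by rewrite B0 (subset_trans BS) ?subsetUr.
    by split; [apply/set0Pn; exists a; rewrite !inE eqxx|rewrite setUS].
  - move=> x; rewrite SE inE => /orP[|xLR].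
      rewrite inE => /eqP->.
      have [B qB kB] : exists2 B, B \in q & k \in B by apply: ex; rewrite inE kR orbT.
      exists (a |: B); last by rewrite !inE eqxx.
      by apply/imsetP; exists B => //; rewrite kB.
    have [B qB xB] := ex x xLR.
    exists (if k \in B then a |: B else B); first by apply: imset_f.
    by case: ifP; rewrite // inE xB orbT.
  move=> _ _ x /imsetP[B qB ->] /imsetP[B' qB' ->].
  have [->|xa] := eqVneq x a.
    have h C : C \in q -> a \in (if k \in C then a |: C else C) -> k \in C.
      by move=> qC; case: ifP => // _; rewrite (negbTE (naB C qC)).
    by move=> /(h _ qB) kB /(h _ qB') kB'; rewrite (un _ _ _ qB qB' kB kB').
  have h C : x \in (if k \in C then a |: C else C) -> x \in C.
    by case: ifP => // _; rewrite !inE (negbTE xa).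
  by move=> /h xB /h xB'; rewrite (un _ _ _ qB qB' xB xB').
apply/noncrossingP => _ _ i j m l /imsetP[B qB ->] /imsetP[B' qB' ->].
have h x C : C \in q -> x \in (if k \in C then a |: C else C) -> x = a /\ k \in C \/ x \in C.
  move=> qC; case: ifP => kC; last by right.
  by rewrite !inE => /predU1P[->|]; [left|right].
move=> /(h _ _ qB) iB /(h _ _ qB') jB /(h _ _ qB) mB /(h _ _ qB') lB /andP[ij jm] ml.
have inS x C : C \in q -> x \in C -> x \in L :|: R by move=> qC; apply: (subsetP (sub C qC).2).
have ai : (a <= i)%N by case: iB => [[->//]|/(inS _ _ qB)/aL/ltnW].
have {}jB : j \in B' by case: jB => // -[ja _]; move: ij; rewrite ja ltnNge ai.
have {}mB : m \in B by case: mB => // -[ma _]; move: jm; rewrite ma ltnNge (leq_trans ai) // ltnW.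
have {}lB : l \in B'.
  by case: lB => // -[la _]; move: ml; rewrite la ltnNge (leq_trans ai) // ltnW // (ltn_trans ij).
suff -> : B = B' by [].
case: iB => [[ia kB]|iB]; last by apply: (nc B B' i j m l) => //; rewrite ij.
have BR := kRB B qB kB; have mR := subsetP BR m mB.
have lR : l \in R.
  have := inS _ _ qB' lB; rewrite inE => /orP[lL|//].
  by have := LR lL mR; rewrite ltnNge (ltnW ml).
have B'R : B' \subset R.
  case/orP: (sp B' qB') => // /subsetP/(_ l lB) lL.
  by have := LR lL lR; rewrite ltnn.
have := kmin (subsetP B'R j jB); rewrite leq_eqVlt => /orP[/eqP kj|kj].
  by apply: (un B B' k) => //; rewrite (val_inj kj).
by apply: (nc B B' k j m l) => //; rewrite kj.
Qed.

Lemma attachK q : q \in NCon (L :|: R) -> detach (attach q) = q.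
Proof.
rewrite inE => /andP[/partition_blocksP[sub ex un] _].
rewrite /detach /attach -imset_comp -[RHS]imset_id; apply: eq_in_imset => B qB /=.
have aB : a \notin B by apply: contra aS => aB; apply: (subsetP (sub B qB).2).
by case: ifP => _; rewrite ?setU1K //; apply/setDidPl; rewrite disjoint_sym disjoints1.
Qed.

Lemma card_attach q : q \in NCon (L :|: R) -> #|attach q| = #|q|.
Proof.
move=> qN; apply: card_in_imset => B B' qB qB' E.
have aB C : C \in q -> a \notin C.
  move: qN; rewrite inE => /andP[/partition_blocksP[sub _ _] _] qC.
  by apply: contra aS => aC; apply: (subsetP (sub C qC).2).
have h C : C \in q -> (if k \in C then a |: C else C) :\ a = C.
  by move=> qC; case: ifP => _; rewrite ?setU1K ?aB //; apply/setDidPl;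
    rewrite disjoint_sym disjoints1 aB.
by rewrite -(h B qB) -(h B' qB') E.
Qed.

(** A block containing points of both [L] and [R] would cross the arc from [a] to [k]. *)
Lemma detach_NC p : p \in NCon S -> follows p ->
  [/\ detach p \in NCon (L :|: R), split_at (detach p) & attach (detach p) = p].
Proof.
rewrite inE => /andP[/partition_blocksP[sub ex un] /noncrossingP nc].
case/exists_inP=> A pA /and3P[aA kA dA].
have onlyA B : B \in p -> a \in B -> B = A by move=> pB aB; apply: (un _ _ a).
have onlyAk B : B \in p -> k \in B -> B = A by move=> pB kB; apply: (un _ _ k).
have inLR B x : B \in p -> x \in B -> x != a -> x \in L :|: R.
  by move=> pB xB xa; have := subsetP (sub B pB).2 x xB; rewrite SE inE in_set1 (negbTE xa).
have AR x : x \in A -> x != a -> x \in R.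
  move=> xA xa; have := inLR A x pA xA xa; rewrite inE => /orP[xL|//].
  by rewrite (disjointFr dA xA) in xL.
split.
- rewrite inE; apply/andP; split.
    apply/partition_blocksP; split.
    + move=> _ /imsetP[B pB ->]; split; last first.
        by apply/subsetP => x; rewrite !inE => /andP[xa xB]; have := inLR B x pB xB xa;
          rewrite inE.
      have [->|BA] := eqVneq B A; first by apply/set0Pn; exists k; rewrite !inE eq_sym ak.
      have /set0Pn[x xB] := (sub B pB).1; apply/set0Pn; exists x; rewrite !inE xB andbT.
      by apply: contraNneq BA => xa; rewrite (onlyA B) // -xa.
    + move=> x xLR; have [B pB xB] : exists2 B, B \in p & x \in B by apply: ex;
        rewrite SE inE xLR orbT.
      exists (B :\ a); first exact: imset_f.
      by rewrite !inE xB andbT; apply: contraNneq aS => <-.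
    move=> _ _ x /imsetP[B pB ->] /imsetP[B' pB' ->]; rewrite !inE.
    by move=> /andP[_ xB] /andP[_ xB']; rewrite (un _ _ _ pB pB' xB xB').
  apply/noncrossingP => _ _ i j m l /imsetP[B pB ->] /imsetP[B' pB' ->].
  rewrite !inE => /andP[_ iB] /andP[_ jB] /andP[_ mB] /andP[_ lB] ijm ml.
  by rewrite (nc B B' i j m l).
- apply/forall_inP => _ /imsetP[B pB ->]; apply/orP.
  have [BA|BA] := eqVneq B A.
    by right; apply/subsetP => x; rewrite BA !inE => /andP[xa xA]; apply: AR.
  have aB : a \notin B by apply: contra BA => /(onlyA _ pB) ->.
  have kB : k \notin B by apply: contra BA => /(onlyAk _ pB) ->.
  have -> : B :\ a = B by apply/setDidPl; rewrite disjoint_sym disjoints1.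
  have [/pred0P BL|/pred0Pn[x /andP[xB xL]]] := boolP [disjoint B & L].
    right; apply/subsetP => x xB.
    have := inLR B x pB xB; rewrite inE; have /= := BL x; rewrite xB /= => -> /=.
    by apply; apply: contraNneq aB => <-.
  have {}xB : x \in B by []. have {}xL : x \in L by [].
  left; apply/subsetP => y yB.
  have := inLR B y pB yB; rewrite inE => /(_ _)/orP[|//|yR].
    by apply: contraNneq aB => <-.
  case/negP: BA; apply/eqP/esym; apply: (nc A B a x k y) => //.
    by rewrite (aL _) ?LR // inE xL.
  have := kmin yR; rewrite leq_eqVlt => /orP[/eqP/val_inj ky|//].
  by move: kB; rewrite ky yB.
rewrite /attach /detach -imset_comp -[RHS]imset_id; apply: eq_in_imset => B pB /=.
rewrite !inE eq_sym ak /=; case: ifP => kB.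
  by rewrite setD1K // (onlyAk B).
apply/setDidPl; rewrite disjoint_sym disjoints1; apply/negP => /(onlyA _ pB) BA.
by move: kB; rewrite BA kA.
Qed.

Variables (K : comNzRingType) (c : K).

Definition NCweight (X : {set T}) : K := \sum_(p in NCon X) c ^+ #|p|.

(** The blocks inside [L] and inside [R] can be chosen independently, as they cannot cross. *)
Lemma sum_split_at : [disjoint L & R] ->
  \sum_(q in NCon (L :|: R) | split_at q) c ^+ #|q| = NCweight L * NCweight R.
Proof.
move=> dLR; rewrite /NCweight big_distrlr /= pair_big /=.
pose pr (X : {set T}) q := [set B : {set T} in q | B \subset X].
have LRB B : B != set0 -> B \subset L -> B \subset R -> False.
  move=> /set0Pn[x xB] /subsetP/(_ x xB) xL /subsetP/(_ x xB).
  by rewrite (disjointFr dLR).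
rewrite (reindex_onto (fun pp : {set {set T}} * {set {set T}} => pp.1 :|: pp.2)
  (fun q => (pr L q, pr R q))) /=; last first.
  move=> q /andP[_ /forall_inP sp]; apply/setP => B; rewrite !inE -andb_orr.
  by apply: andb_idr; exact: sp.
have NCsub q X : q \in NCon (L :|: R) -> split_at q -> (X == L) || (X == R) ->
    pr X q \in NCon X.
  rewrite inE => /andP[/partition_blocksP[sub ex un] /noncrossingP nc] /forall_inP sp XE.
  have XS : X \subset L :|: R by case/orP: XE => /eqP->; rewrite ?subsetUl ?subsetUr.
  rewrite inE; apply/andP; split; last first.
    apply/noncrossingP => B B' i j m l; rewrite !inE => /andP[qB _] /andP[qB' _].
    exact: nc.
  apply/partition_blocksP; split.
  - by move=> B; rewrite inE => /andP[qB BX]; split=> //; exact: (sub B qB).1.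
  - move=> x xX; have [B qB xB] := ex x (subsetP XS x xX); exists B => //.
    rewrite inE qB /=; case/orP: XE => /eqP XE; rewrite XE in xX *; case/orP: (sp B qB) => // BX.
      by have := subsetP BX x xB; rewrite (disjointFr dLR).
    by have := disjointFr dLR (subsetP BX x xB); rewrite xX.
  by move=> B B' x; rewrite !inE => /andP[qB _] /andP[qB' _]; exact: un.
apply: eq_big => [[p1 p2]|[p1 p2]] /=.
  apply/idP/idP => [/andP[/andP[qN sp] /eqP[E1 E2]]|/andP[p1N p2N]].
    have := NCsub _ L qN sp; have := NCsub _ R qN sp.
    by rewrite E1 E2 !eqxx orbT => -> // ->.
  have := p1N; have := p2N; rewrite inE => /andP[/partition_blocksP[sub2 ex2 un2] /noncrossingP
    nc2].
  rewrite inE => /andP[/partition_blocksP[sub1 ex1 un1] /noncrossingP nc1].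
  have cross B B' x : B \in p1 -> B' \in p2 -> x \in B -> x \in B' -> False.
    move=> pB pB' xB xB'; have := subsetP (sub2 B' pB').2 x xB'.
    by rewrite (disjointFr dLR) // (subsetP (sub1 B pB).2).
  rewrite -andbA; apply/and3P; split.
  - rewrite inE; apply/andP; split.
      apply/partition_blocksP; split.
      + move=> B; rewrite inE => /orP[/sub1|/sub2] [B0 BS]; split=> //.
          exact: subset_trans BS (subsetUl _ _).
        exact: subset_trans BS (subsetUr _ _).
      + move=> x; rewrite inE => /orP[/ex1|/ex2] [B pB xB]; exists B => //;
          by rewrite inE pB ?orbT.
      move=> B B' x; rewrite !inE => /orP[pB|pB] /orP[pB'|pB'] xB xB'.
      + exact: (un1 _ _ x).
      + by case: (cross B B' x).
      + by case: (cross B' B x).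
      + exact: (un2 _ _ x).
    apply/noncrossingP => B B' i j m l; rewrite !inE => /orP[pB|pB] /orP[pB'|pB'] iB jB mB lB ijm
      ml.
    + exact: (nc1 _ _ i j m l).
    + have := LR (subsetP (sub1 _ pB).2 m mB) (subsetP (sub2 _ pB').2 j jB).
      by case/andP: ijm => _ jm; rewrite ltnNge ltnW.
    + have := LR (subsetP (sub1 _ pB').2 j jB) (subsetP (sub2 _ pB).2 i iB).
      by case/andP: ijm => ij _; rewrite ltnNge ltnW.
    + exact: (nc2 _ _ i j m l).
  - apply/forall_inP => B; rewrite inE => /orP[/sub1|/sub2] [_ ->] //; by rewrite orbT.
  apply/eqP; congr pair; apply/setP => B; rewrite !inE; apply/andP/idP.
  - case=> /orP[//|pB] BL; have [B0 BR] := sub2 B pB; by case: (LRB B).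
  - by move=> pB; rewrite pB; split=> //; exact: (sub1 B pB).2.
  - case=> /orP[pB|//] BL; have [B0 BR] := sub1 B pB; by case: (LRB B).
  - by move=> pB; rewrite pB orbT; split=> //; exact: (sub2 B pB).2.
move=> /andP[/andP[qN _] /eqP[E1 E2]]; rewrite -exprD -cardsUI.
rewrite (_ : p1 :&: p2 = set0) ?cards0 ?addn0 //; apply/setP => B; rewrite !inE.
apply/negP => /andP[pB1 pB2].
have BL : B \subset L by move: (pB1); rewrite -{1}E1 inE => /andP[].
have BR : B \subset R by move: (pB2); rewrite -{1}E2 inE => /andP[].
by move: qN; rewrite inE => /andP[/partition_blocksP[sub _ _] _];
  apply: (LRB B (sub B _).1 BL BR); rewrite inE pB1.
Qed.

Lemma sum_follows : [disjoint L & R] ->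
  \sum_(p in NCon S | follows p) c ^+ #|p| = NCweight L * NCweight R.
Proof.
move=> dLR; rewrite -sum_split_at // (reindex_onto attach detach) /=; last first.
  by move=> p /andP[pN fp]; have [] := detach_NC pN fp.
apply: eq_big => q; last first.
  case/andP=> /andP[pN fp] /eqP E; have [+ _ _] := detach_NC pN fp; rewrite E => qN.
  by rewrite card_attach.
apply/idP/idP => [/andP[/andP[pN fp] /eqP E]|/andP[qN sp]].
  by have [+ + _] := detach_NC pN fp; rewrite E => -> ->.
by rewrite attach_NC //= attachK.
Qed.

End Peel.

Section Recursion.
Variables (K : comNzRingType) (c : K) (S : {set T}) (a : T).
Hypotheses (aS : a \in S) (amin : forall x, x \in S -> (a <= x)%N).
Let S' := S :\ a.
Let Lo k := [set x in S' | (x < k)%N].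
Let Hi k := [set x in S' | (k <= x)%N].

Lemma sum_singleton :
  \sum_(p in NCon S | [set a] \in p) c ^+ #|p| = c * NCweight c S'.
Proof.
rewrite /NCweight big_distrr /=.
rewrite (reindex_onto (fun q => [set a] |: q) (fun p => p :\ [set a])) /=; last first.
  by move=> p /andP[_ ap]; rewrite setD1K.
have aq q : q \in NCon S' -> [set a] \notin q.
  rewrite inE => /andP[/partition_blocksP[sub _ _] _]; apply/negP => /sub[_].
  by rewrite sub1set !inE eqxx.
apply: eq_big => q; last first.
  by case/andP=> _ /eqP E; rewrite cardsU1 exprD -{1}E !inE eqxx expr1.
apply/idP/idP; last first.
  move=> qN; have := aq q qN; move: qN; rewrite !inE eqxx /= => /andP[/partition_blocksP[sub ex
    un] /noncrossingP nc] aqn.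
  have nS B : B \in q -> a \notin B.
    by move=> qB; apply/negP => /(subsetP (sub B qB).2); rewrite !inE eqxx.
  rewrite setU1K // eqxx !andbT; apply/andP; split.
    apply/partition_blocksP; split.
    - move=> B; rewrite !inE => /predU1P[->|qB].
        by rewrite sub1set aS; split=> //; apply/set0Pn; exists a; rewrite inE.
      have [B0 BS] := sub B qB; split=> //; exact: subset_trans BS (subsetDl _ _).
    - move=> x xS; have [->|xa] := eqVneq x a; first by exists [set a]; rewrite !inE eqxx.
      have [B qB xB] : exists2 B, B \in q & x \in B by apply: ex; rewrite !inE xa.
      by exists B => //; rewrite inE qB orbT.
    move=> B B' x; rewrite !inE => /predU1P[->|qB] /predU1P[->|qB']; rewrite ?inE //.
    - by move=> /eqP->; rewrite (negbTE (nS _ qB')).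
    - by move=> + /eqP xa; rewrite xa (negbTE (nS _ qB)).
    exact: un.
  apply/noncrossingP => B B' i j m l; rewrite !inE => /predU1P[->|qB] /predU1P[->|qB'];
    rewrite ?inE //.
  - by move=> /eqP-> _ /eqP-> _ /andP[aj ja]; move: aj; rewrite ltnNge ltnW.
  - by move=> _ /eqP-> _ /eqP-> /andP[_ am] ma; move: am; rewrite ltnNge ltnW.
  exact: nc.
rewrite !inE eqxx /= => /andP[/andP[/andP[/partition_blocksP[sub ex un] /noncrossingP nc] _] /eqP
  E].
have qE B : B \in q -> B \in [set a] |: q /\ B != [set a].
  by move=> qB; split; [rewrite inE qB orbT|rewrite -E !inE in qB; case/andP: qB].
have aB B : B \in q -> a \notin B.
  move=> /qE[qB]; apply: contra => aB; apply/eqP; apply: (un _ _ a) => //; by rewrite !inE eqxx.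
apply/andP; split.
  apply/partition_blocksP; split.
  - move=> B qB; have [B0 BS] := sub B (qE B qB).1; split=> //; apply/subsetP => x xB.
    rewrite !inE (subsetP BS) // andbT; apply: contraTneq xB => ->; exact: aB.
  - move=> x; rewrite !inE => /andP[xa /ex[B]]; rewrite inE => /orP[|qB xB]; last by exists B.
    by rewrite inE => /eqP-> ; rewrite inE (negbTE xa).
  by move=> B B' x /qE[qB _] /qE[qB' _]; exact: un.
by apply/noncrossingP => B B' i j m l /qE[qB _] /qE[qB' _]; exact: nc.
Qed.

Lemma Lo_Hi k : Lo k :|: Hi k = S'.
Proof. by apply/setP => x; rewrite !inE -andb_orr ltnNge orNb andbT. Qed.

(** The value [a] stands for a singleton block. *)
Definition next_in_block p := odflt a [pick k in S' | follows (Lo k) a k p].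

Lemma NCweight_rec : NCweight c S =
  c * NCweight c S' + \sum_(k in S') NCweight c (Lo k) * NCweight c (Hi k).
Proof.
have aS' : a \notin S' by rewrite !inE eqxx.
have SE : S = a |: S' by rewrite setD1K.
have LoE x m : x \in S' -> (x \in Lo m) = (x < m)%N by move=> xS; rewrite /Lo inE xS.
have fwd p k : p \in NCon S -> k \in S' -> follows (Lo k) a k p -> next_in_block p = k.
  rewrite inE => /andP[/partition_blocksP[_ _ un] _] kS fk; rewrite /next_in_block;
    case: pickP => [m|/(_ k)]; last by rewrite kS fk.
  move=> /andP[mS fm] /=.
  case/exists_inP: fk => A pA /and3P[aA kA dA]; case/exists_inP: fm => B pB /and3P[aB mB dB].
  have AB := un _ _ _ pA pB aA aB; rewrite -AB in mB dB.
  have := disjointFr dA mB; have := disjointFr dB kA; rewrite !LoE // => km mk.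
  by apply/val_inj/anti_leq; rewrite [(m <= k)%N]leqNgt [(k <= m)%N]leqNgt km mk.
(* if the block of a is not a singleton, its least other point follows a *)
have nextE p : p \in NCon S -> (next_in_block p == a) = ([set a] \in p).
  move=> pN; have := pN; rewrite inE => /andP[/partition_blocksP[sub ex un] _].
  apply/eqP/idP => [|ap]; last first.
    rewrite /next_in_block; case: pickP => // k /andP[kS /exists_inP[A pA /and3P[aA kA _]]].
    have AE := un A [set a] a pA ap aA (set11 a).
    by move: kS; rewrite AE inE in kA; rewrite !inE kA.
  move=> na; have [A pA aA] := ex a aS.
  have [/eqP <-//|] := boolP (A == [set a]) => An.
  have /set0Pn[m mA] : A :\ a != set0.
    apply: contra An => /eqP E; apply/eqP; rewrite -(setD1K aA) E setU0 //.
  case: (arg_minnP (fun x : T => val x) mA) => k + kmin;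
    change (k \in A :\ a -> [set a] \in p) => kA.
  have kS : k \in S'.
    by move: kA; rewrite !inE => /andP[-> kA]; exact: (subsetP (sub A pA).2).
  have fk : follows (Lo k) a k p.
    apply/exists_inP; exists A => //; rewrite aA /=; move: kA; rewrite inE => /andP[_ ->] /=.
    apply/pred0P => x; apply/negP => /= /andP[xA].
    change (x \in Lo k -> False); rewrite !inE => /andP[/andP[xa _]].
    have xA' : x \in A :\ a by rewrite !inE xa.
    by rewrite ltnNge (kmin x xA').
  by have := kS; rewrite -(fwd p k pN kS fk) na !inE eqxx.
rewrite {1}/NCweight (partition_big next_in_block (mem S)) /=; last first.
  move=> p pN; rewrite /next_in_block; case: pickP => [k /andP[+ _]|_]; last exact: aS.
  by rewrite !inE => /andP[].
rewrite (bigD1 a) //=; congr (_ + _).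
  rewrite -sum_singleton; apply: eq_bigl => p; case: (boolP (p \in _)) => //= pN; exact: nextE.
apply: eq_big => k; first by rewrite !inE andbC.
case/andP=> kS ka; have kS' : k \in S' by rewrite !inE ka.
rewrite -(@sum_follows S (Lo k) (Hi k) a k _ _ _ _ _ _ K c) ?Lo_Hi //.
- apply: eq_bigl => p; case: (boolP (p \in _)) => //= pN; apply/eqP/idP; last exact: fwd.
  rewrite /next_in_block; case: pickP => [m /andP[mS fm] /= <- //|_ /= ak].
  by rewrite ak eqxx in ka.
- by move=> x; rewrite !inE => /andP[xa xS]; rewrite ltn_neqAle amin // andbT eq_sym.
- by move=> x y; rewrite !inE => /andP[_ xk] /andP[_ ky]; exact: leq_trans ky.
- by rewrite !inE ka kS leqnn.
- by move=> y; rewrite !inE => /andP[].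
by apply/pred0P => x /=; rewrite !inE ltnNge; case: (_ <= _)%N; rewrite ?andbF.
Qed.

End Recursion.

Lemma NCweight0 (K : comNzRingType) (c : K) : NCweight c set0 = 1.
Proof.
rewrite /NCweight (big_pred1 set0) ?cards0 // => p; rewrite inE;
  apply/andP/eqP => [[/partition_blocksP[sub _ _] _]|->].
  apply/setP => B; rewrite inE; apply/negP => /sub[B0]; by rewrite subset0 (negbTE B0).
split; first by apply/partition_blocksP; split=> B; rewrite inE.
by apply/noncrossingP => B B' i j k l; rewrite inE.
Qed.

Definition ord_itv (a b : nat) := [set x : T | (a <= x < b)%N].

End Noncrossing.

Section Moments.
Variables (K : comNzRingType) (c : K).

Definition NCsum n : K := NCweight c [set: 'I_n].

Lemma big_ord_itv (F : nat -> K) N a L : (a + L <= N)%N ->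
  \sum_(k < N | (a <= k < a + L)%N) F k = \sum_(j < L) F (a + j)%N.
Proof.
move=> aLN; rewrite (eq_bigr (fun j : 'I_L => F (j + a)%N)) => [|j _]; last by rewrite addnC.
rewrite -[RHS](big_mkord xpredT (fun j => F (j + a)%N)) -{2}(addKn a L).
rewrite -(big_addn 0 (a + L) a xpredT) add0n (big_nat_widen _ _ N) // big_geq_mkord.
by apply: eq_bigl => k; rewrite andbC.
Qed.

Lemma NCsum0 : NCsum 0 = 1.
Proof.
by rewrite /NCsum (_ : [set: 'I_0] = set0) ?NCweight0 //; apply/setP => -[].
Qed.

Lemma NCweight_itv_rec L N a : (a + L < N)%N ->
  NCweight c (@ord_itv N a (a + L.+1)) =
  c * NCweight c (@ord_itv N a.+1 (a.+1 + L)) +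
  \sum_(k < N | (a.+1 <= k < a.+1 + L)%N)
     NCweight c (@ord_itv N a.+1 k) * NCweight c (@ord_itv N k (a.+1 + L)).
Proof.
move=> aLN; have aN : (a < N)%N by rewrite (leq_ltn_trans _ aLN) ?leq_addr.
pose o := Ordinal aN; set S := ord_itv _ _ _.
have S'E : S :\ o = @ord_itv N a.+1 (a.+1 + L).
  by apply/setP => x; rewrite !inE -val_eqE /=; lia.
rewrite (@NCweight_rec _ _ _ S o); last 2 first.
- by rewrite inE /= leqnn addnS ltnS leq_addr.
- by move=> x; rewrite inE => /andP[].
rewrite S'E; congr (_ + _); apply: eq_big => k; first by rewrite inE.
rewrite inE => /andP[ak kb]; congr (_ * _); congr NCweight.
  by apply/setP => x; move: ak kb; rewrite !inE -?val_eqE /=; lia.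
by apply/setP => x; move: ak kb; rewrite !inE -?val_eqE /=; lia.
Qed.

(** The weight of an interval depends on its length only, since the recursion does; no
    transport of partitions along translations is involved. *)
Lemma NCweight_itv L N a : (a + L <= N)%N ->
  NCweight c (@ord_itv N a (a + L)) = NCsum L.
Proof.
elim/ltn_ind: L N a => -[|L] IH N a aLN.
  rewrite NCsum0 (_ : ord_itv _ _ _ = set0) ?NCweight0 //.
  by apply/setP => x; rewrite !inE addn0 ltnNge; case: (a <= x)%N.
have rec M b : (b + L < M)%N -> NCweight c (@ord_itv M b (b + L.+1)) =
    c * NCsum L + \sum_(j < L) NCsum j * NCsum (L - j).
  move=> bLM; rewrite NCweight_itv_rec // IH //; congr (_ + _).
  rewrite (eq_bigr (fun k : 'I_M => NCsum (k - b.+1) * NCsum (b.+1 + L - k))).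
    rewrite (big_ord_itv (fun k => NCsum (k - b.+1) * NCsum (b.+1 + L - k))) //.
    by apply: eq_bigr => j _; rewrite addKn subnDl.
  move=> k /andP[bk kb].
  rewrite -{1}(subnKC bk) IH; [|lia|lia].
  have {1}-> : (b.+1 + L = k + (b.+1 + L - k))%N by lia.
  by rewrite IH //; lia.
rewrite rec; last by lia.
have -> : NCsum L.+1 = NCweight c (@ord_itv L.+1 0 (0 + L.+1)).
  by congr NCweight; apply/setP => x; rewrite !inE /= add0n ltn_ord.
by rewrite rec.
Qed.

(** The index [i] counts the points from [k] on, where [k] is the successor of the first point
    in its block; [i = 0] stands for a singleton block, of weight [c]. *)
Lemma NCsumS n : NCsum n.+1 =
  \sum_(i < n.+1) (if i == 0%N :> nat then c else NCsum i) * NCsum (n - i).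
Proof.
rewrite -(@NCweight_itv n.+1 n.+1 0) // NCweight_itv_rec // NCweight_itv //.
rewrite big_ord_recl subn0; congr (_ + _).
rewrite (eq_bigr (fun k : 'I_n.+1 => NCsum (k - 1) * NCsum (1 + n - k))).
  rewrite (big_ord_itv (fun k => NCsum (k - 1) * NCsum (1 + n - k))) //.
  rewrite (reindex_inj rev_ord_inj); apply: eq_bigr => j _ /=.
  by rewrite [LHS]mulrC /bump /=; congr (NCsum _ * NCsum _); have := ltn_ord j; lia.
move=> k /andP[k1 kn].
rewrite -{1}(subnKC k1) NCweight_itv; last by lia.
have {1}-> : (1 + n = k + (1 + n - k))%N by lia.
by rewrite NCweight_itv //; lia.
Qed.

End Moments.

(** * Sequences, convolutions and bounds on partial sums *)

Section StrongRec.
Variables (A : Type) (a0 : A) (G : nat -> (nat -> A) -> A).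
Hypothesis Gext : forall n f g, (forall i, (i <= n)%N -> f i = g i) -> G n f = G n g.

(** [rec_table n] holds the correct values up to [n]. *)
Fixpoint rec_table n : nat -> A :=
  if n is m.+1 then fun i => if (i <= m)%N then rec_table m i else G m (rec_table m)
  else fun=> a0.

Lemma strong_rec : exists f : nat -> A, f 0 = a0 /\ forall n, f n.+1 = G n f.
Proof.
exists (fun n => rec_table n n); split=> // n /=; rewrite ltnn; apply: Gext => i.
elim: n => [|n IHn]; first by rewrite leqn0 => /eqP->.
rewrite leq_eqVlt => /predU1P[->//|]; rewrite ltnS => li.
by rewrite -IHn //= li.
Qed.
End StrongRec.

Section Cauchy.
Variable K : comNzRingType.

Definition seq_conv (a b : nat -> K) n := \sum_(i < n.+1) a i * b (n - i)%N.

Lemma seq_convC a b n : seq_conv a b n = seq_conv b a n.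
Proof.
rewrite /seq_conv (reindex_inj rev_ord_inj); apply: eq_bigr => i _ /=.
by rewrite mulrC subSS subKn // -ltnS.
Qed.

Definition psum (a : nat -> K) w N := \sum_(n < N) a n * w ^+ n.

Lemma psumS a w N : psum a w N.+1 = a 0 + w * psum (fun n => a n.+1) w N.
Proof.
rewrite /psum big_ord_recl expr0 mulr1; congr (_ + _); rewrite big_distrr /=.
by apply: eq_bigr => i _; rewrite exprS mulrCA.
Qed.

Lemma psum_recr a w N : psum a w N.+1 = psum a w N + a N * w ^+ N.
Proof. by rewrite /psum big_ord_recr. Qed.

(** The product of two truncated series exceeds the truncated convolution by the terms of
    index at least [N]. *)
Lemma psum_mul a b w N : psum a w N * psum b w N = psum (seq_conv a b) w N +
  \sum_(i < N) \sum_(j < N | (N <= i + j)%N) a i * w ^+ i * (b j * w ^+ j).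
Proof.
rewrite /psum big_distrlr /=.
rewrite (eq_bigr (fun i : 'I_N => \sum_(j < N | (i + j < N)%N) a i * w ^+ i * (b j * w ^+ j) +
   \sum_(j < N | (N <= i + j)%N) a i * w ^+ i * (b j * w ^+ j))); last first.
  move=> i _; rewrite (bigID (fun j : 'I_N => (i + j < N)%N)) /=; congr (_ + _).
  by apply: eq_bigl => j; rewrite -leqNgt.
rewrite big_split /=; congr (_ + _).
rewrite [RHS](eq_bigr (fun n : 'I_N => \sum_(i < N | (i <= n)%N) a i * b (n - i)%N * w ^+ n)).
  rewrite [RHS](exchange_big_dep xpredT) //=; apply: eq_bigr => i _.
  rewrite -(big_mkord (fun j => (i + j < N)%N) (fun j => a i * w ^+ i * (b j * w ^+ j))).
  rewrite -(big_geq_mkord i N xpredT (fun n => a i * b (n - i)%N * w ^+ n)).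
  rewrite -[RHS]/(\sum_(0 + i <= n < N) a i * b (n - i)%N * w ^+ n) big_addn.
  rewrite (big_nat_widen _ (N - i) N) ?leq_subr //; apply: eq_big => j; first by lia.
  by move=> _; rewrite addnK exprD; ring.
move=> n _; rewrite /seq_conv big_distrl /= (big_ord_widen N (fun i => a i * b (n - i)%N * w ^+
  n)) //.
Qed.

Lemma psumD (a b : nat -> K) x N : psum (fun n => a n + b n) x N = psum a x N + psum b x N.
Proof. by rewrite /psum -big_split; apply: eq_bigr => i _; rewrite mulrDl. Qed.

Lemma psumZ k (b : nat -> K) x N : psum (fun n => k * b n) x N = k * psum b x N.
Proof. by rewrite /psum mulr_sumr; apply: eq_bigr => i _; rewrite mulrA. Qed.

Lemma eq_psum (a b : nat -> K) x N : a =1 b -> psum a x N = psum b x N.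
Proof. by move=> ab; apply: eq_bigr => i _; rewrite ab. Qed.

End Cauchy.

Section Bounds.
Variables (R : realFieldType) (c : R) (M M' : nat -> R).
Hypothesis c0 : 0 < c.
Hypothesis M0 : M 0 = 1.
Hypothesis MS : forall n, M n.+1 = seq_conv M M n + (c - 1) * M n.
Hypothesis M'0 : M' 0 = 0.
Hypothesis M'S : forall n, M' n.+1 = seq_conv M' M n *+ 2 + (c - 1) * M' n + n%:R * M n.

Lemma seq_conv_ge0 (a b : nat -> R) n :
  (forall i, (i <= n)%N -> 0 <= a i) -> (forall i, (i <= n)%N -> 0 <= b i) ->
  0 <= seq_conv a b n.
Proof.
move=> ha hb; apply: sumr_ge0 => i _; rewrite mulr_ge0 ?ha ?hb ?leq_subr //; by rewrite -ltnS.
Qed.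

Lemma seq_conv_ge (a : nat -> R) n :
  (forall i, (i <= n)%N -> 0 <= a i) -> (forall i, (i <= n)%N -> 0 <= M i) ->
  a n <= seq_conv a M n.
Proof.
move=> ha hM; rewrite /seq_conv big_ord_recr /= subnn M0 mulr1 lerDr.
by apply: sumr_ge0 => i _; rewrite mulr_ge0 ?ha ?hM ?leq_subr // ltnW.
Qed.

(** [c - 1] may be negative, but the convolution contains the term [M n * M 0]. *)
Lemma M_ge0 n : 0 <= M n.
Proof.
elim/ltn_ind: n => -[|n] IH; first by rewrite M0.
rewrite MS mulrBl mul1r addrCA; apply: addr_ge0; first by rewrite mulr_ge0 ?IH ?ltW.
by rewrite subr_ge0; apply: seq_conv_ge => i i_n; apply: IH.
Qed.

Lemma M'_ge0 n : 0 <= M' n.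
Proof.
elim/ltn_ind: n => -[|n] IH; first by rewrite M'0.
rewrite M'S; apply: addr_ge0; last by rewrite mulr_ge0 ?M_ge0 ?ler0n.
rewrite mulrBl mul1r addrCA; apply: addr_ge0; first by rewrite mulr_ge0 ?IH ?ltW.
rewrite subr_ge0.
have IH' i : (i <= n)%N -> 0 <= M' i by move=> i_n; apply: IH.
rewrite mulr2n (le_trans (seq_conv_ge IH' _)) ?lerDl ?seq_conv_ge0 // => i _; exact: M_ge0.
Qed.

Lemma psum_ge0 (a : nat -> R) x N : (forall n, 0 <= a n) -> 0 <= x -> 0 <= psum a x N.
Proof. by move=> a0 x0; apply: sumr_ge0 => i _; rewrite mulr_ge0 ?exprn_ge0. Qed.

Lemma psum_conv_le (a b : nat -> R) x N : (forall n, 0 <= a n) -> (forall n, 0 <= b n) -> 0 <= x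
  ->
  psum (seq_conv a b) x N <= psum a x N * psum b x N.
Proof.
move=> ha hb x0; rewrite psum_mul lerDl; apply: sumr_ge0 => i _; apply: sumr_ge0 => j _.
by rewrite !mulr_ge0 ?exprn_ge0.
Qed.

(** If the sum [F] of the first terms is at most 2, then the next one is at most [1 + x F (F +
    c - 1)], again at most 2. *)
Lemma psum_M_le2 x N : 0 <= x -> x * (4 + 2 * c) <= 1 -> psum M x N <= 2.
Proof.
move=> x0 x1; elim: N => [|N IHN]; first by rewrite /psum big_ord0.
rewrite psumS M0 (eq_psum _ _ MS) psumD psumZ.
have F0 := psum_ge0 N M_ge0 x0; have := psum_conv_le N M_ge0 M_ge0 x0.
set F := psum M x N in IHN F0 *; set C := psum _ _ _ => CF.
have FF : F * F <= 2 * F by rewrite ler_wpM2r.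
have cF : c * F <= c * 2 by rewrite ler_wpM2l // ltW.
have : C + (c - 1) * F <= 4 + 2 * c by lra.
by move/(ler_wpM2l x0)/le_trans/(_ x1); lra.
Qed.

(** [n <= 2 ^ n]. *)
Lemma psum_nat_le (x : R) N : 0 <= x -> psum (fun n => n%:R * M n) x N <= psum M (2 * x) N.
Proof.
move=> x0; apply: ler_sum => i _.
rewrite exprMn mulrA ler_wpM2r ?exprn_ge0 // mulrC ler_wpM2l ?M_ge0 //.
by rewrite -natrX ler_nat ltnW // ltn_expl.
Qed.

(** As for [psum_M_le2]; the equation for [M'] is linear, with coefficients controlled by the
    bounds on the sums of [M]. *)
Lemma psum_M'_le1 x N : 0 <= x -> x * (8 + 4 * c) <= 1 -> psum M' x N <= 1.
Proof.
move=> x0 x1; elim: N => [|N IHN]; first by rewrite /psum big_ord0.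
rewrite psumS M'0 add0r (eq_psum _ _ M'S) psumD psumD psumZ.
have -> : psum (fun n => seq_conv M' M n *+ 2) x N = psum (seq_conv M' M) x N *+ 2.
  by rewrite mulr2n -psumD; apply: eq_psum => n; rewrite mulr2n.
have F0 := psum_ge0 N M_ge0 x0; have := psum_conv_le N M'_ge0 M_ge0 x0.
have H0 := psum_ge0 N M'_ge0 x0.
have F2 : psum M x N <= 2 by apply: psum_M_le2; nra.
have D2 : psum (fun n => n%:R * M n) x N <= 2.
  have x2 : 0 <= 2 * x by lra.
  by apply: le_trans (psum_nat_le N x0) _; apply: psum_M_le2 => //; nra.
set F := psum M x N in F0 F2 *; set H := psum M' x N in IHN H0 *.
set C := psum _ _ _; set D := psum _ _ _ in D2 * => CF.
have : C <= F by nra.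
have : 0 <= C by apply: psum_ge0 => // n; apply: seq_conv_ge0 => i _;
  [exact: M'_ge0|exact: M_ge0].
move=> C0 CF1.
have cH : c * H <= c * 1 by rewrite ler_wpM2l // ltW.
have : C *+ 2 + (c - 1) * H + D <= 8 + 4 * c by rewrite mulrBl mul1r mulr2n;
  move: c0 cH CF1 F2 D2 H0 IHN => *; lra.
by move/(ler_wpM2l x0)/le_trans; apply.
Qed.

End Bounds.

From mathcomp Require Import complex.
From mathcomp Require Import all_classical all_reals all_analysis.
Import numFieldNormedType.Exports.
Local Open Scope ring_scope.

(** * Annular non-crossing permutations as matchings of one polygon *)

Lemma porbit_conj (T : finType) (s t : {perm T}) x :
  porbit (s ^ t)%g (t x) = (t @: porbit s x)%SET.
Proof.
apply/setP => y; apply/porbitP/imsetP => [[i ->]|[z /porbitP[i ->] ->]].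
  by exists ((s ^+ i)%g x); rewrite ?mem_porbit // -conjXg permJ.
by exists i; rewrite -conjXg permJ.
Qed.

Lemma card_porbits_conj (T : finType) (s t : {perm T}) :
  #|porbits (s ^ t)%g| = #|porbits s|.
Proof.
have -> : porbits (s ^ t)%g = ((fun A : {set T} => t @: A) @: porbits s)%SET.
  apply/setP => A; apply/imsetP/imsetP => [[x _ ->]|[_ /imsetP[x _ ->] ->]].
    exists (porbit s (t^-1 x)%g); first exact: imset_f.
    by rewrite -porbit_conj permKV.
  by exists (t x) => //; rewrite porbit_conj.
by apply: card_imset; apply: imset_inj; exact: perm_inj.
Qed.

Lemma card_porbits_prod (I : finType) (s : {perm bool * I}) (u : bool -> {perm I}) :
  (forall b i, s (b, i) = (b, u b i)) ->
  #|porbits s| = (#|porbits (u false)| + #|porbits (u true)|)%N.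
Proof.
move=> su.
have sX k b i : ((s ^+ k) (b, i) = (b, (u b ^+ k) i))%g.
  by rewrite !permX; elim: k => //= k ->; rewrite su.
pose emb (b : bool) (A : {set I}) := [set (b, i) | i in A]%SET.
have pE b i : porbit s (b, i) = emb b (porbit (u b) i).
  apply/setP => y; apply/porbitP/imsetP => [[k ->]|[z /porbitP[k ->] ->]].
    by exists ((u b ^+ k)%g i); rewrite ?mem_porbit // sX.
  by exists k; rewrite sX.
have inj b : injective (emb b).
  by apply: imset_inj => x y [].
have psE : porbits s = (emb false @: porbits (u false) :|: emb true @: porbits (u true))%SET.
  apply/setP => A; rewrite inE; apply/imsetP/orP => [[[[] i] _ ->]|].
  - by right; rewrite pE; apply/imset_f/imset_f.
  - by left; rewrite pE; apply/imset_f/imset_f.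
  by case=> /imsetP[_ /imsetP[i _ ->] ->]; [exists (false, i)|exists (true, i)]; rewrite ?pE.
rewrite psE cardsU (card_imset _ (inj false)) (card_imset _ (inj true)).
suff -> : (emb false @: porbits (u false) :&: emb true @: porbits (u true) = finset.set0)%SET.
  by rewrite cards0 subn0.
apply/setP => A; rewrite !inE; apply/negP => /andP[/imsetP[_ /imsetP[i _ ->] ->]].
case/imsetP => _ /imsetP[j _ ->] /setP /(_ (false, i)).
rewrite imset_f ?porbit_id // => /esym/imsetP[k _ []//].
Qed.

Lemma fcycle_iota n : fcycle (fun k => k.+1 %% n)%N (iota 0 n).
Proof.
case: n => // n.
have H l k : (k + l <= n)%N -> fpath (fun k => k.+1 %% n.+1)%N k (iota k.+1 l).
  elim: l k => //= l IHl k kl; rewrite modn_small ?eqxx /=; last by lia.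
  by apply: IHl; lia.
rewrite /= rcons_path H ?add0n //=.
rewrite (last_nth 0%N) size_iota; case: (n) => // m.
by rewrite -[nth _ _ _]/(nth 0%N (iota 1 m.+1) m) nth_iota // add1n modnn.
Qed.

Section Sn.
Variable n : nat.
Hypothesis n0 : (0 < n)%N.

Lemma deltaE b i : delta n (b, i) = (~~ b, i).
Proof. by rewrite permE. Qed.

Lemma gammaE (x : pm n) : gamma n x = gamma_fun x.
Proof. by rewrite permE. Qed.

Lemma gammaVE b i : ((gamma n)^-1)%g (b, i) = if b then (true, i) else (false, ord_pred i).
Proof.
apply: (perm_inj (s := gamma n)); rewrite permKV gammaE /gamma_fun.
by case: b => //=; rewrite ord_predK.
Qed.

Lemma tgammaE b i : tgamma n (b, i) = if b then (true, ord_pred i) else (false, ordS i).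
Proof.
rewrite /tgamma /rtl_mul !permM deltaE gammaVE.
by case: b => /=; rewrite deltaE gammaE.
Qed.

(** The second matching: [delta] joins [k] to [-k], and [tdelta] joins [-k] to [k + 1]. *)
Definition tdelta : {perm pm n} := (delta n * tgamma n)%g.

Lemma tdeltaE b i : tdelta (b, i) = if b then (false, ordS i) else (true, ord_pred i).
Proof. by rewrite permM deltaE tgammaE; case: b. Qed.

Lemma delta_matching : matching (delta n).
Proof. by apply/forallP => -[b i]; rewrite !deltaE negbK eqxx xpair_eqE; case: b. Qed.

Lemma tdelta_matching : matching tdelta.
Proof.
by apply/forallP => -[[] i]; rewrite !tdeltaE ?ordSK ?ord_predK eqxx.
Qed.

Lemma pairingE (T : finType) (p : {perm T}) : pairing p = matching p.
Proof.
apply: eq_forallb => x; apply/eqP/andP => [p2|[/eqP ppx px]].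
  have := porbit_traject p x; rewrite p2 /= => E.
  have := iter_porbit p x; rewrite p2 /= => ->; split=> //.
  have := uniq_traject_porbit p x; rewrite p2 /= inE andbT eq_sym.
  by [].
have -> : porbit p x = [set x; p x]%SET; last by rewrite cards2 eq_sym px.
apply/setP => y; rewrite !inE; apply/porbitP/orP => [[i ->]|].
  rewrite permX; elim: i => [|i /= [/eqP->|/eqP->]]; first by left.
    by right.
  by left; rewrite ppx.
by case=> /eqP->; [exists 0%N; rewrite perm1|exists 1%N; rewrite expg1].
Qed.

Definition circle : seq (pm n) := [seq (false, i) | i <- enum 'I_n].

(** The two matchings form one polygon, whose half set is the circle of positive points. *)
Lemma circle_polygon : polygons (delta n) tdelta [:: circle].
Proof.
have mem x : (x \in circle) = ~~ x.1.
  apply/mapP/idP => [[i _ ->]//|]; case: x => [[]//= i _]; exists i => //.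
  by rewrite mem_enum.
split.
- exact: delta_matching.
- exact: tdelta_matching.
- rewrite /= cats0; split; first by rewrite map_inj_uniq ?enum_uniq // => x y [].
  by move=> [b i]; rewrite deltaE !mem /= => ->.
- move=> s; rewrite inE => /eqP->; rewrite /circle cycle_map.
  rewrite (@eq_cycle _ _ (relpre val (frel (fun k => k.+1 %% n)%N))).
    by rewrite -cycle_map val_enum_ord; exact: fcycle_iota.
  by move=> x y; rewrite /= /turn /= deltaE tdeltaE /= xpair_eqE.
by move=> [b i]; rewrite !inE /= cats0 !mem deltaE; case: b.
Qed.

Lemma porbits_ordS : #|porbits (perm (@ordS_inj n))| = 1%N.
Proof.
set g := perm _.
have gX k (i : 'I_n) : (i = 0 :> nat)%N -> (k < n)%N -> (g ^+ k)%g i = k :> nat.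
  move=> i0; elim: k => [|k IHk] kn; first by rewrite perm1.
  by rewrite expgSr permM permE /= IHk 1?ltnW // modn_small.
pose o : 'I_n := Ordinal n0.
have all_o i : porbit g i = porbit g o.
  apply/eqP; rewrite eq_porbit_mem; apply/porbitP; exists i.
  by apply: val_inj; rewrite /= gX.
apply/eqP/cards1P; exists (porbit g o); apply/setP => A; rewrite inE.
apply/imsetP/eqP => [[i _ ->]//|->]; by exists o.
Qed.

(** If [s] preserves signs, both counts are twice the counts of permutations [u] and [g u^-1]
    of {1, .., n}, where [g] is the long cycle. Those two add up to n + 1 modulo 2, by
    comparing signatures. *)
Lemma sign_preserving_parity (s : {perm pm n}) :
  (forall b i, (s (b, i)).1 = b) ->
  (forall x, delta n (s x) = (s^-1)%g (delta n x)) ->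
  (#|porbits s| + #|porbits (tgamma n * s^-1)%g| <> 2 * n)%N.
Proof.
move=> ss sd.
pose u_fun (b : bool) (i : 'I_n) := (s (b, i)).2.
have u_inj b : injective (u_fun b).
  move=> i j ij; have : s (b, i) = s (b, j).
    by rewrite [LHS]surjective_pairing [RHS]surjective_pairing !ss /= -/(u_fun b i) ij.
  by move/perm_inj => [].
pose u b := perm (u_inj b).
have su b i : s (b, i) = (b, u b i) by rewrite [LHS]surjective_pairing ss permE.
have uV i : u true i = (u false)^-1%g i.
  apply: (perm_inj (s := u false)); rewrite permKV.
  have := sd (true, i); rewrite su !deltaE /= => /(congr1 s); rewrite permKV su.
  by case.
have uVE : u true = (u false)^-1%g by apply/permP.
pose g := perm (@ordS_inj n).
pose w (b : bool) := if b then (g^-1 * u false)%g else (g * (u false)^-1)%g.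
have tw b i : (tgamma n * s^-1)%g (b, i) = (b, w b i).
  apply: (perm_inj (s := s)); rewrite permM permKV tgammaE su /w.
  case: b; rewrite /= permM.
    rewrite uVE permK; congr (_, _); apply: (perm_inj (s := g)).
    by rewrite permKV permE /= ord_predK.
  by rewrite permKV permE.
rewrite (card_porbits_prod su) (card_porbits_prod tw) /w uVE porbitsV.
have -> : #|porbits (g^-1 * u false)%g| = #|porbits (g * (u false)^-1)%g|.
  rewrite -porbitsV invMg invgK -(card_porbits_conj _ (u false)^-1); congr #|porbits _|.
  by rewrite conjgE invgK mulgA mulKVg.
move=> E.
have := odd_permM g (u false)^-1%g; rewrite odd_permV /odd_perm porbits_ordS card_ord.
have : odd (#|porbits (u false)| + #|porbits (g * (u false)^-1)%g|) = odd n.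
  by congr odd; lia.
rewrite oddD.
by case: (odd n); case: (odd #|porbits (u false)|); case: (odd #|porbits (g * _)%g|).
Qed.

Lemma tgamma_orbit b (i j : 'I_n) : (b, j) \in porbit (tgamma n) (b, i).
Proof.
pose g := perm (@ordS_inj n).
pose u (c : bool) := if c then g^-1%g else g.
have tu c k : tgamma n (c, k) = (c, u c k).
  rewrite tgammaE /u; case: c => //=; last by rewrite permE.
  by congr (_, _); apply: (perm_inj (s := g)); rewrite permKV permE /= ord_predK.
have sX k c l : ((tgamma n ^+ k) (c, l) = (c, (u c ^+ k) l))%g.
  by rewrite !permX; elim: k => //= k ->; rewrite tu.
have : porbit (u b) i = porbit (u b) j.
  have /eqP/cards1P[A AE] : #|porbits (u b)| = 1%N.
    by rewrite /u; case: (b); rewrite ?porbitsV porbits_ordS.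
  have := imset_f (porbit (u b)) (x := i) (D := 'I_n) isT.
  have := imset_f (porbit (u b)) (x := j) (D := 'I_n) isT.
  by rewrite -/(porbits _) AE !inE => /eqP-> /eqP->.
move/eqP; rewrite eq_sym eq_porbit_mem => /porbitP[k ->].
by apply/porbitP; exists k; rewrite sX.
Qed.

Lemma sign_change_transitive (s : {perm pm n}) b i :
  (s (b, i)).1 != b -> [transitive <<[set s; tgamma n]>>%g, on [set: pm n] | 'P].
Proof.
move=> sb; set G := <<_>>%g.
have gG k : (tgamma n ^+ k)%g \in G by rewrite groupX // mem_gen // !inE eqxx orbT.
have sG : s \in G by rewrite mem_gen // !inE eqxx.
have same c k l : (c, l) \in orbit 'P G (c, k).
  have /porbitP[m ->] := tgamma_orbit c k l; exact: (mem_orbit 'P (c, k) (gG m)).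
have cross k : (~~ b, k) \in orbit 'P G (b, i).
  apply: (@orbit_trans _ _ _ _ _ (s (b, i))); last exact: (mem_orbit 'P _ sG).
  have -> : s (b, i) = (~~ b, (s (b, i)).2); last exact: same.
  by rewrite [LHS]surjective_pairing; move: sb; case: (s (b, i)).1; case: (b).
apply/imsetP; exists (b, i); first by rewrite inE.
apply/esym/setP => -[c k]; rewrite inE.
case: (eqVneq c b) => [->|cb]; first exact: same.
have -> : c = ~~ b by move: cb; case: (c); case: (b).
exact: cross.
Qed.

(** Transitivity follows from the cycle count: a sign change links the two orbits of [tgamma],
    and without sign changes the count would contradict [sign_preserving_parity]. *)
Lemma mem_SNCdelta (p : {perm pm n}) :
  ((delta n * p)%g \in SNCdelta n) =
  matching p && (#|porbits (delta n * p)%g| + #|porbits (tdelta * p)%g| == 2 * n)%N.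
Proof.
(* products of permutations are read from left to right here: s = delta * p *)
have dd : (delta n * delta n = 1)%g.
  by apply/permP => x; rewrite permM perm1 matchingK // delta_matching.
have dV : (delta n)^-1%g = delta n by exact: mulg1_eq.
rewrite inE /rtl_mul mulgA dd mul1g pairingE [LHS]andbA [LHS]andbC.
case: (boolP (matching p)) => //= mp.
have pp : (p * p = 1)%g by apply/permP => x; rewrite permM perm1 matchingK.
have pV : p^-1%g = p by exact: mulg1_eq.
have cE : #|porbits (tgamma n * (delta n * p)^-1)%g| = #|porbits (tdelta * p)%g|.
  rewrite -[RHS](card_porbits_conj _ (delta n)) conjgE invMg dV pV /tdelta.
  by move: (tgamma n) => g; rewrite !mulgA dd mul1g.
rewrite cE; case: eqP => E; last by rewrite andbF.
apply/idP; case: (boolP [exists x, ((delta n * p)%g x).1 != x.1]) => [/existsP[[b i]]|].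
  by move=> h; rewrite (sign_change_transitive h).
rewrite negb_exists => /forallP sgn; case: (@sign_preserving_parity (delta n * p)%g).
- by move=> b i; apply/eqP; have := sgn (b, i); rewrite negbK.
- by move=> x; rewrite invMg dV pV !permM.
by rewrite cE.
Qed.

End Sn.

(** For one polygon with 2n vertices and no frozen point the top degree is 2n + 2, so that
    degree 2n carries the second coefficient. The square root [s] of [c] absorbs the exponent
    [#(s) / 2]. *)
Lemma mp_moment'_leading (R : realType) (c : R) (M M' : nat -> R) (n : nat) : 0 < c ->
  M 0 = 1 ->
  (forall n, M n.+1 = \sum_(i < n.+1) (if i == 0%N :> nat then c else M i) * M (n - i)%N) ->
  M' 0 = 0 ->
  (forall n, M' n.+1 =
     \sum_(i < n.+1) (M' i * M (n - i)%N + (if i == 0%N :> nat then c else M i) * M' (n - i)%N)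
     + n%:R * M n) ->
  (0 < n)%N -> mp_moment' c n = M' n.
Proof.
move=> c0 M0 MS M'0 M'S n0; set s := Num.sqrt c.
have s0 : s != 0 by rewrite gt_eqF // sqrtr_gt0.
have s2 : s ^+ 2 = c by rewrite sqr_sqrtr // ltW.
rewrite -s2 in MS M'S.
have P := circle_polygon n.
have sz : size (circle n) = n by rewrite size_map size_enum_ord.
have ne : [::] \notin [:: circle n] by rewrite inE eq_sym -size_eq0 sz -lt0n.
have cardT : #|{: pm n}| = n.*2 by rewrite card_prod card_bool card_ord mul2n.
have he : (0 + (size (flatten [:: circle n])).*2 = #|{: pm n}|)%N.
  by rewrite /= cats0 sz cardT.
have [_ _ /(_ (2 * n)%N)] := matching_sum_leading s0 M0 MS M'0 M'S P ne he.
rewrite /top_degree cardT /= expr0 mul1r mulr1 mulr0 addr0 sz => <-; last by lia.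
rewrite /mp_moment' /matching_sum (reindex_inj (mulgI (delta n))) /=; apply: eq_big => p.
  rewrite mem_SNCdelta //; congr (_ && _); symmetry; apply: andb_idl => _.
  apply/forallP => x; rewrite !inE /= cats0.
  have mem (y : pm n) : (y \in circle n) = ~~ y.1.
    apply/mapP/idP => [[i _ ->]//|]; case: y => [[]//= i _]; exists i => //.
    by rewrite mem_enum.
  by case: x => [b i]; rewrite !mem deltaE /=; case: b.
by move=> _; rewrite mulrC powRrM powR12_sqrt ?ltW // powR_mulrn ?sqrtr_ge0.
Qed.

Local Open Scope classical_set_scope.
Local Open Scope ring_scope.

(** * Limits of the partial sums *)

Lemma sqr_le_exp2 n : (n * n <= 2 ^ n.+1)%N.
Proof.
elim: n => // -[|[|[|n]]] // IH; rewrite expnS; lia.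
Qed.

Section Limits.
Variables (K : numFieldType).
Hypothesis half_cvg0 : (fun N => 2^-1 ^+ N : K) @ \oo --> (0 : K).

Lemma cvg0_le (u v : nat -> K) : (forall n, `|u n| <= `|v n|) ->
  v @ \oo --> (0 : K) -> u @ \oo --> (0 : K).
Proof.
move=> uv /cvgr0Pnorm_lt v0; apply/cvgr0Pnorm_lt => e e0.
by apply: filterS (v0 e e0) => n; apply: le_lt_trans.
Qed.

Lemma cvg0_geom (u : nat -> K) k : (forall n, `|u n| <= k * 2^-1 ^+ n) -> u @ \oo --> (0 : K).
Proof.
move=> uk; apply: (@cvg0_le _ (fun n => k * 2^-1 ^+ n)).
  move=> n; apply: le_trans (uk n) _; apply: real_ler_norm.
  by rewrite ger0_real // (le_trans _ (uk n)).
by rewrite -(mulr0 k); apply: cvgM; [exact: cvg_cst|exact: half_cvg0].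
Qed.

(** The sequences [u n] are eventually invertible, since [v] is. *)
Lemma cvg_div (x u : nat -> K) l v : v != 0 -> u @ \oo --> (v : K) ->
  (fun n => x n * u n) @ \oo --> (l : K) -> x @ \oo --> l / v.
Proof.
move=> v0 uv xl; have H : (fun n => x n * u n * (u n)^-1) @ \oo --> l / v.
  by apply: cvgM; [exact: xl|exact: cvgV].
apply: cvg_trans H.
apply: near_eq_cvg; near=> n => /=; rewrite mulfK //; near: n.
exact: cvgr_neq0 uv v0.
Unshelve. all: by end_near. Qed.

Lemma cvg_scaled_sub (x : nat -> K) (k l a : K) : x @ \oo --> (l : K) ->
  (fun n => k * (x n - a)) @ \oo --> (k * (l - a) : K).
Proof.
move=> xl; apply: cvgM; first exact: cvg_cst.
by apply: cvgB => //; exact: cvg_cst.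
Qed.

Variables (r w : K).
Hypotheses (r0 : 0 < r) (wr : `|w| * 4 <= r).

(** Growth of [a] at most that of [r ^- n]; the argument [w] has modulus at most [r / 4]. *)
Definition slow (a : nat -> K) := forall n, `|a n| * r ^+ n <= 2.

Lemma slow_le a n : slow a -> `|a n * w ^+ n| <= 2 * 4^-1 ^+ n.
Proof.
move=> sa; rewrite normrM normrX.
apply: (@le_trans _ _ (`|a n| * (r / 4) ^+ n)).
  rewrite ler_wpM2l //; apply: lerXn2r; rewrite ?nnegrE ?normr_ge0 ?ler_pdivlMr //.
  by rewrite mul0r ltW.
by rewrite exprMn mulrA ler_wpM2r // exprn_ge0.
Qed.

Lemma quarter_le n : 4^-1 ^+ n <= 2^-1 ^+ n :> K.
Proof. by rewrite lerXn2r ?nnegrE ?invr_ge0 // lef_pV2 ?posrE // ler_nat. Qed.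

Lemma slow_cvg0 a : slow a -> (fun n => a n * w ^+ n) @ \oo --> (0 : K).
Proof.
move=> sa; apply: (@cvg0_geom _ 2) => n; apply: le_trans (slow_le n sa) _.
by rewrite ler_wpM2l // quarter_le.
Qed.

(** The error consists of at most [N ^ 2] terms, each bounded by [4 * 4^-1 ^+ N]. *)
Lemma seq_conv_error_cvg0 a b : slow a -> slow b ->
  (fun N => psum a w N * psum b w N - psum (seq_conv a b) w N) @ \oo --> (0 : K).
Proof.
move=> sa sb; apply: (@cvg0_geom _ 8) => N.
rewrite psum_mul addrC addKr.
apply: (@le_trans _ _ (\sum_(i < N) \sum_(j < N) 4 * 4^-1 ^+ N)).
  apply: le_trans (ler_norm_sum _ _ _) _; apply: ler_sum => i _.
  apply: le_trans (ler_norm_sum _ _ _) _; rewrite [leRHS](bigID (fun j : 'I_N => (N <= i + j)%N))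
    /=.
  have t0 : 0 <= 4 * 4^-1 ^+ N :> K by rewrite mulr_ge0 ?exprn_ge0 ?invr_ge0.
  apply: ler_wpDr; first by apply: sumr_ge0 => j _.
  apply: ler_sum => j ij; rewrite normrM.
  apply: (@le_trans _ _ (2 * 4^-1 ^+ i * (2 * 4^-1 ^+ j))).
    by rewrite ler_pM ?slow_le.
  rewrite mulrACA -exprD -natrM ler_wpM2l // ler_wiXn2l ?invr_ge0 // invf_le1 // ler1n //.
rewrite !sumr_const card_ord -mulrnA -[_ *+ (N * N)]mulr_natr.
have -> : 4^-1 ^+ N = 2^-1 ^+ N * (2 ^ N)%:R^-1 :> K.
  rewrite natrX -exprVn -exprMn -invfM -natrM //.
have NN : (N * N)%:R <= (2 ^ N.+1)%:R :> K by rewrite ler_nat sqr_le_exp2.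
have p2 : 0 < (2 ^ N)%:R :> K by rewrite ltr0n expn_gt0.
have h0 : 0 <= 2^-1 ^+ N :> K by rewrite exprn_ge0 ?invr_ge0.
apply: (@le_trans _ _ (4 * (2^-1 ^+ N * (2 ^ N)%:R^-1) * (2 ^ N.+1)%:R)).
  by rewrite ler_wpM2l // !mulr_ge0 // invr_ge0 ltW.
rewrite expnS natrM (_ : _ * _ = 8 * 2^-1 ^+ N) //.
by move: (2^-1 ^+ N) h0 => h _; field; rewrite gt_eqF.
Qed.

Section Equations.
Variables (c : K) (m m' : nat -> K).
Hypothesis m0 : m 0 = 1.
Hypothesis mS : forall n, m n.+1 = seq_conv m m n + (c - 1) * m n.
Hypothesis m'0 : m' 0 = 0.
Hypothesis m'S : forall n, m' n.+1 = seq_conv m' m n *+ 2 + (c - 1) * m' n + n%:R * m n.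
Let d n := n%:R * m n.
Hypotheses (sm : slow m) (sm' : slow m') (sd : slow d).
Hypothesis mle2 : forall N, `|psum m w N| <= 2.
Variables (L L' : K).
Hypothesis w0 : w != 0.
Hypothesis LD : w * (L + L') = 1 - w * (c - 1).
Hypothesis LM : w * (L * L') = 1.
Hypothesis L'3 : 3 <= `|L'|.
Let u := 1 - w * (c - 1) - 2 * w * L.
Hypothesis u0 : u != 0.

Let err a b N := psum a w N * psum b w N - psum (seq_conv a b) w N.

Let psum_convE a b N : psum (seq_conv a b) w N = psum a w N * psum b w N - err a b N.
Proof. by rewrite /err opprB addrC subrK. Qed.

Let cvg0D (f g : nat -> K) : f @ \oo --> (0 : K) -> g @ \oo --> (0 : K) ->
  (fun n => f n + g n) @ \oo --> (0 : K).
Proof. by move=> f0 g0; rewrite -[X in _ --> X]addr0; apply: cvgD. Qed.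

Let cvg0Z k (g : nat -> K) : g @ \oo --> (0 : K) -> (fun n => k * g n) @ \oo --> (0 : K).
Proof. by move=> g0; rewrite -[X in _ --> X](mulr0 k); apply: cvgM => //; exact: cvg_cst. Qed.

(** With [p] the partial sums, [w (p - L) (p - L')] tends to 0 by the quadratic equation, and
    [p - L'] stays away from 0 because [p] is bounded by 2 and [L'] by 3 from below. *)
Lemma psum_m_cvg : psum m w @ \oo --> (L : K).
Proof.
apply/subr_cvg0; pose eps N := m N * w ^+ N + w * err m m N.
have eps0 : eps @ \oo --> (0 : K).
  by apply: cvg0D; [exact: slow_cvg0|apply: cvg0Z; exact: seq_conv_error_cvg0].
apply: (cvg0_le _ (cvg0Z w^-1 eps0)) => N.
(* eps is the amount by which the partial sum fails to solve the quadratic equation *)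
have E : w * ((psum m w N - L) * (psum m w N - L')) = eps N.
  have := psumS m w N; rewrite psum_recr m0 (eq_psum _ _ mS) psumD psumZ psum_convE.
  rewrite /eps; move: (psum m w N) (err m m N) (m N * w ^+ N) => p e x px.
  have -> : x = 1 + w * (p * p - e + (c - 1) * p) - p by rewrite -px addrC addKr.
  by transitivity (w * (p * p) - w * (L + L') * p + w * (L * L')); [ring|rewrite LD LM; ring].
have p1 : 1 <= `|psum m w N - L'|.
  rewrite distrC; apply: le_trans (lerB_dist _ _); rewrite lerBrDr.
  by apply: le_trans L'3; rewrite -[3]/(1 + 2 : K) lerD2l.
rewrite -E mulKf // normrM ler_peMr //.
Qed.

Let un N := 1 - w * (c - 1) - 2 * w * psum m w N.

Let un_cvg : un @ \oo --> (u : K).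
Proof.
apply: cvgB; first exact: cvg_cst.
by apply: cvgM; [exact: cvg_cst|exact: psum_m_cvg].
Qed.

(** Since [n = 1 + i + (n - 1 - i)], multiplying the recursion of [m] by [n] gives a linear
    equation for [n m n], the coefficient form of the derivative of the quadratic equation. *)
Lemma psum_d_cvg : psum d w @ \oo --> ((L - 1) / u : K).
Proof.
apply: (cvg_div u0 un_cvg).
pose eps N := - (d N * w ^+ N) - 2 * (w * err d m N) + m N * w ^+ N.
have eps0 : eps @ \oo --> (0 : K).
  apply: cvg0D; last exact: slow_cvg0.
  apply: cvg0D; first by rewrite -oppr0; apply: cvgN; exact: slow_cvg0.
  by rewrite -oppr0; apply: cvgN; do 2!apply: cvg0Z; exact: seq_conv_error_cvg0.
have -> : (fun N => psum d w N * un N) = (fun N => (psum m w N - 1) + eps N).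
  apply/funext => N.
  have dS n : d n.+1 = m n.+1 + (2 * seq_conv d m n + (c - 1) * d n).
    have -> : 2 * seq_conv d m n = n%:R * seq_conv m m n.
      rewrite -[2]/(1 + 1 : K) mulrDl mul1r {2}(seq_convC d m) /seq_conv -big_split big_distrr /=.
      apply: eq_bigr => i _; rewrite /d.
      have -> : n%:R = i%:R + (n - i)%:R :> K by rewrite -natrD subnKC // -ltnS.
      ring.
    by rewrite /d -natr1 mulrDl mul1r addrC {2}mS; ring.
  have d0 : d 0 = 0 by rewrite /d mul0r.
  have := psumS d w N; rewrite psum_recr d0 add0r (eq_psum _ _ dS) psumD psumD !psumZ psum_convE.
  rewrite mulrDr.
  have -> : w * psum (fun n => m n.+1) w N = psum m w N + m N * w ^+ N - 1.
    by rewrite -psum_recr psumS m0 addrC addKr.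
  rewrite /eps /un; move: (psum d w N) (psum m w N) (err d m N) (d N * w ^+ N) (m N * w ^+ N).
  move=> D p e x y Dx; have -> : x = p + y - 1 + w * (2 * (D * p - e) + (c - 1) * D) - D by
    rewrite -Dx addrC addKr.
  ring.
rewrite -[X in _ --> X]addr0; apply: cvgD => //; apply: cvgB; [exact: psum_m_cvg|exact: cvg_cst].
Qed.

Lemma psum_m'_cvg : psum m' w @ \oo --> (w * ((L - 1) / u) / u : K).
Proof.
apply: (cvg_div u0 un_cvg).
pose eps N := - (m' N * w ^+ N) - 2 * (w * err m' m N).
have eps0 : eps @ \oo --> (0 : K).
  apply: cvg0D; first by rewrite -oppr0; apply: cvgN; exact: slow_cvg0.
  by rewrite -oppr0; apply: cvgN; do 2!apply: cvg0Z; exact: seq_conv_error_cvg0.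
have -> : (fun N => psum m' w N * un N) = (fun N => w * psum d w N + eps N).
  apply/funext => N.
  have m'S' n : m' n.+1 = 2 * seq_conv m' m n + (c - 1) * m' n + d n.
    by rewrite m'S -mulr_natl.
  have := psumS m' w N; rewrite psum_recr m'0 add0r (eq_psum _ _ m'S') psumD psumD !psumZ
    psum_convE.
  rewrite /eps /un; move: (psum m' w N) (psum d w N) (psum m w N) (err m' m N) (m' N * w ^+ N).
  move=> H D p e x Hx; have -> : x = w * (2 * (H * p - e) + (c - 1) * H + D) - H by rewrite -Hx
    addrC addKr.
  ring.
rewrite -[X in _ --> X]addr0; apply: cvgD => //; apply: cvgM; [exact: cvg_cst|exact: psum_d_cvg].
Qed.

End Equations.
End Limits.

Local Open Scope complex_scope.

(** * The transforms at a point of large modulus *)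

Section Recursions.
Variables (R : realType) (c : R).
Local Notation M := (NCsum c).

(** The weight [c] of the empty first part, instead of [f 0 = 1], is moved out of the
    convolution. *)
Lemma weighted_conv (f g : nat -> R) n : f 0 = 1 ->
  \sum_(i < n.+1) (if i == 0%N :> nat then c else f i) * g (n - i)%N = seq_conv f g n + (c - 1) *
    g n.
Proof.
by move=> f0; rewrite /seq_conv !big_ord_recl /= f0 subn0; ring.
Qed.

Lemma NCsum_conv n : M n.+1 = seq_conv M M n + (c - 1) * M n.
Proof. by rewrite NCsumS weighted_conv // NCsum0. Qed.

Lemma mp_moment'_rec : 0 < c -> exists M' : nat -> R,
  [/\ M' 0 = 0,
      forall n, M' n.+1 = seq_conv M' M n *+ 2 + (c - 1) * M' n + n%:R * M n
    & forall n, (0 < n)%N -> mp_moment' c n = M' n].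
Proof.
move=> c0.
have [|M' [M'0 M'S]] := @strong_rec R 0
    (fun n f => seq_conv f M n *+ 2 + (c - 1) * f n + n%:R * M n).
  move=> n f g fg; rewrite fg //; congr (_ *+ 2 + _ + _).
  by apply: eq_bigr => i _; rewrite fg // -ltnS.
exists M'; split=> // n n0.
apply: (mp_moment'_leading (M := M)) => // [|k|k]; first exact: NCsum0.
  exact: NCsumS.
rewrite M'S big_split /= weighted_conv ?NCsum0 // -/(seq_conv M' M k) (seq_convC M) mulr2n; ring.
Qed.

End Recursions.

Section Core.
Variable R : realType.
Local Notation C := R[i].

(** A positive complex number is the image of a positive real one, so that the real geometric
    sequence can be used. *)
Lemma half_cvg0 : (fun N => 2^-1 ^+ N : C^o) @ \oo --> (0 : C^o).
Proof.
apply/cvgr0Pnorm_lt => e e0.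
have eE : e = (complex.Re e)%:C by rewrite RRe_real // gtr0_real.
have e0' : 0 < complex.Re e by rewrite -ltcR -eE.
have := @cvg_geometric R 1 2^-1; rewrite ger0_norm ?invr_ge0 // invf_lt1 ?ltr1n // => /(_ isT).
move/cvgr0Pnorm_lt => /(_ _ e0'); apply: filterS => n /=.
rewrite mul1r eE -ltcR; apply: le_lt_trans.
rewrite !ger0_norm ?exprn_ge0 ?invr_ge0 //.
by rewrite rmorphXn /= fmorphV rmorph_nat.
Qed.

Lemma series_psum (a : nat -> R) (z : C^o) N :
  \sum_(1 <= n < N.+1) (a n)%:C / z ^+ n.+1 =
  z^-1 * (psum (fun n => (a n)%:C) z^-1 N.+1 - (a 0)%:C).
Proof.
rewrite /psum big_ord_recl expr0 mulr1 addrC addKr big_add1 big_mkord big_distrr /=.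
by apply: eq_bigr => n _; rewrite /bump leq0n add1n exprVn mulrCA -invfM -exprS.
Qed.

Lemma slow_complex (a : nat -> R) (r : R) : 0 < r -> (forall n, 0 <= a n) ->
  (forall N, psum a r N <= 2) -> slow r%:C (fun n => (a n)%:C).
Proof.
move=> r0 a0 ps n; rewrite ger0_norm ?ler0c // -rmorphXn -rmorphM /=.
have -> : 2 = (2 : R)%:C by rewrite rmorph_nat.
rewrite lecR; apply: le_trans (ps n.+1); rewrite psum_recr lerDr.
by apply: sumr_ge0 => i _; rewrite mulr_ge0 ?exprn_ge0 // ltW.
Qed.

Lemma seq_conv_complex (a b : nat -> R) n :
  (seq_conv a b n)%:C = seq_conv (fun n => (a n)%:C) (fun n => (b n)%:C) n :> C.
Proof. by rewrite /seq_conv rmorph_sum; apply: eq_bigr => i _; rewrite rmorphM. Qed.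

Variable c : R.
Hypothesis c0 : 0 < c.

Lemma mp_aE : (mp_a c)%:C = (1 - (Num.sqrt c)%:C) ^+ 2 :> C.
Proof. by rewrite /mp_a rmorphXn rmorphB rmorph1. Qed.

Lemma mp_bE : (mp_b c)%:C = (1 + (Num.sqrt c)%:C) ^+ 2 :> C.
Proof. by rewrite /mp_b rmorphXn rmorphD rmorph1. Qed.

Lemma sqrt_cE : (Num.sqrt c)%:C ^+ 2 = c%:C :> C.
Proof. by rewrite -rmorphXn /= sqr_sqrtr // ltW. Qed.

Lemma mp_PE (z : C^o) : mp_P c z = z ^+ 2 - 2 * (1 + c%:C) * z + (1 - c%:C) ^+ 2.
Proof. by rewrite /mp_P mp_aE mp_bE -sqrt_cE; ring. Qed.

(** The bound 32 + 16 c serves three purposes: the points beyond it avoid the cut, [1 / z]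
    lies well inside the disc where the bounds on the coefficients apply, and the second root
    of the quadratic equation is large. *)
Lemma mp_ab_le : 0 <= mp_a c <= mp_b c /\ mp_b c <= 32 + 16 * c.
Proof.
rewrite /mp_a /mp_b; have := sqr_sqrtr (ltW c0); have := sqrtr_ge0 c.
set q := Num.sqrt c => q0 qc; rewrite sqr_ge0 /=; split; nra.
Qed.

Section Point.
Variables z s : C^o.
Hypothesis zB : (32 + 16 * c)%:C < `|z|.
Hypothesis s2 : s ^+ 2 = mp_P c z.
Hypothesis sz : `|1 - s / z| < 1 / 2.
Let a : C := (mp_a c)%:C.
Let b : C := (mp_b c)%:C.

Let z0 : z != 0.
Proof.
rewrite -normr_gt0; apply: le_lt_trans zB; rewrite ler0c; have := c0; lra.
Qed.

Let neq_real (t : R) : 0 <= t <= mp_b c -> z - t%:C != 0.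
Proof.
case/andP=> t0 tb; rewrite subr_eq0; apply: contraTneq zB => ->.
rewrite ger0_norm ?ler0c // ltcR -leNgt; apply: le_trans tb _; exact: mp_ab_le.2.
Qed.

Let za : z - a != 0.
Proof. by apply: neq_real; have [/andP[-> ->]] := mp_ab_le. Qed.

Let zb : z - b != 0.
Proof. by apply: neq_real; have [/andP[a0 ab]] := mp_ab_le; rewrite lexx (le_trans a0). Qed.

Let s0 : s != 0.
Proof. by rewrite -sqrf_eq0 s2 mulf_neq0. Qed.

Let L : C := (z + 1 - c%:C - s) / 2.
Let L' : C := (z + 1 - c%:C + s) / 2.

(** [L'] is close to [z], since [s] is close to [z] and [1 - c] is small compared with [z]. *)
Lemma far_root : 3 <= `|L'|.
Proof.
have zs : `|z - s| <= `|z| / 2.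
  have -> : z - s = z * (1 - s / z) by rewrite mulrBr mulr1 mulrC divfK.
  by rewrite normrM ler_wpM2l // (le_trans (ltW sz)) // mul1r.
have zE : z = L' - ((1 - c%:C) / 2 - (z - s) / 2) by rewrite /L'; field.
have cz : `|1 - c%:C| <= `|z| / 4.
  rewrite ler_pdivlMr //; apply: le_trans (ltW zB).
  apply: (@le_trans _ _ ((1 + c%:C) * 4)).
    rewrite ler_wpM2r // (le_trans (ler_normB _ _)) // normr1 ger0_norm // ler0c ltW //.
  have -> : (1 + c%:C) * 4 = ((1 + c) * 4)%:C by rewrite rmorphM rmorphD rmorph1 rmorph_nat.
  by rewrite lecR; have := c0; lra.
have nE (x : C) : `|x| = (complex.Re `|x|)%:C by rewrite RRe_real.
have : `|z| <= `|L'| + (`|1 - c%:C| / 2 + `|z - s| / 2).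
  rewrite {1}zE; apply: le_trans (ler_normB _ _) _; rewrite lerD2l.
  by apply: le_trans (ler_normB _ _) _; rewrite !normrM !normfV !normr_nat.
move: zB zs cz; rewrite [`|z|]nE [`|L'|]nE [`|z - s|]nE [`|1 - c%:C|]nE.
move: (complex.Re _) (complex.Re _) (complex.Re _) (complex.Re _) => x y t v.
have -> : 2 = (2 : R)%:C by rewrite rmorph_nat.
have -> : 3 = (3 : R)%:C by rewrite rmorph_nat.
have -> : 4 = (4 : R)%:C by rewrite rmorph_nat.
rewrite -!fmorphV -!rmorphM -!rmorphD !lecR ltcR /=; have := c0; lra.
Qed.

Let w : C := z^-1.

Let w0 : w != 0. Proof. by rewrite invr_eq0. Qed.

Let LD : w * (L + L') = 1 - w * (c%:C - 1).
Proof. by rewrite /w /L /L'; field. Qed.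

Let LM : w * (L * L') = 1.
Proof.
have -> : L * L' = ((z + 1 - c%:C) ^+ 2 - s ^+ 2) / 4 by rewrite /L /L'; field.
by rewrite s2 mp_PE /w; field.
Qed.

Let uE : 1 - w * (c%:C - 1) - 2 * w * L = s / z.
Proof. by rewrite /w /L; field. Qed.

Let r : R := (8 + 4 * c)^-1.

Let r0 : 0 < r. Proof. by rewrite invr_gt0; have := c0; lra. Qed.

Let rK : r * (8 + 4 * c) = 1.
Proof. by rewrite mulVf // gt_eqF //; have := c0; lra. Qed.

Let wr : `|w| * 4 <= r%:C.
Proof.
rewrite /w normfV mulrC ler_pdivrMr ?normr_gt0 // -ler_pdivrMl ?ltcR //.
apply: le_trans (ltW zB); rewrite -fmorphV /= /r invrK.
have -> : 4 = (4 : R)%:C by rewrite rmorph_nat.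
by rewrite -rmorphM lecR; have := c0; lra.
Qed.

Local Notation M := (NCsum c).
Local Notation Mc := (fun n => (M n)%:C : C).

Let M_ge0 := M_ge0 c0 (NCsum0 c) (NCsum_conv c).

Let Mc0 : Mc 0 = 1. Proof. by rewrite /= NCsum0. Qed.

Let McS n : Mc n.+1 = seq_conv Mc Mc n + (c%:C - 1) * Mc n.
Proof. by rewrite /= NCsum_conv rmorphD rmorphM rmorphB rmorph1 /= seq_conv_complex. Qed.

Let psumM x N : 0 <= x -> x <= r -> psum M x N <= 2.
Proof.
move=> x0 xr; apply: (psum_M_le2 c0 (NCsum0 c) (NCsum_conv c)) => //.
have := rK; have := c0; nra.
Qed.

Let slowM : slow r%:C Mc.
Proof. by apply: slow_complex => // N; apply: psumM; rewrite // ltW. Qed.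

Let slowd : slow r%:C (fun n => n%:R * Mc n).
Proof.
have -> : (fun n => n%:R * Mc n) = (fun n => (n%:R * M n)%:C).
  by apply/funext => n; rewrite rmorphM rmorph_nat.
apply: slow_complex => // [n|N]; first by rewrite mulr_ge0 ?ler0n.
have r2 : 0 <= 2 * r by have := r0; lra.
apply: le_trans (psum_M_le2 c0 (NCsum0 c) (NCsum_conv c) N r2 _).
  exact: (psum_nat_le c0 (NCsum0 c) (NCsum_conv c) N (ltW r0)).
by have := rK; lra.
Qed.

Let psumM2 N : `|psum Mc w N| <= 2.
Proof.
have nE (x : C) : `|x| = (complex.Re `|x|)%:C by rewrite RRe_real.
have x0 : 0 <= complex.Re `|w| by rewrite -ler0c -nE.
have xr : complex.Re `|w| <= r.
  rewrite -lecR -nE; apply: le_trans wr; rewrite ler_peMr //.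
  by rewrite (ler_nat _ 1 4).
apply: le_trans (ler_norm_sum _ _ _) _.
rewrite (eq_bigr (fun n : 'I_N => (M n * complex.Re `|w| ^+ n)%:C)) => [|n _].
  by rewrite -rmorph_sum -[2]/(2%:R) -(rmorph_nat (real_complex R)) lecR psumM.
by rewrite normrM normrX [`|w|]nE rmorphM rmorphXn ger0_norm ?ler0c.
Qed.

Let u0 : s / z != 0. Proof. by rewrite mulf_neq0 ?invr_eq0. Qed.

Let r0C : 0 < r%:C :> C. Proof. by rewrite ltcR. Qed.

Lemma Gsum_cvg : Gsum c z @ \oo --> (w * (L - 1) : C^o).
Proof.
rewrite -cvg_shiftS.
have -> : (fun N => Gsum c z N.+1) = (fun N => w * (psum Mc w N.+1 - 1)).
  by apply/funext => N; rewrite -[1]Mc0; exact: (series_psum M).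
have pcv := psum_m_cvg half_cvg0 r0C wr Mc0 McS slowM psumM2 w0 LD LM far_root.
apply: cvg_scaled_sub.
by move: pcv; rewrite -cvg_shiftS.
Qed.

Lemma gsum_cvg : gsum c z @ \oo --> ((L - 1) / s ^+ 2 : C^o).
Proof.
have [M' [M'0 M'S M'E]] := mp_moment'_rec c0.
pose Mc' n : C := (M' n)%:C.
have Mc'0 : Mc' 0 = 0 by rewrite /Mc' M'0.
have Mc'S n : Mc' n.+1 = seq_conv Mc' Mc n *+ 2 + (c%:C - 1) * Mc' n + n%:R * Mc n.
  by rewrite /Mc' M'S !mulr2n !rmorphD !rmorphM rmorphB rmorph1 rmorph_nat /= seq_conv_complex.
have slowM' : slow r%:C Mc'.
  apply: slow_complex => // [n|N].
    exact: (M'_ge0 c0 (NCsum0 c) (NCsum_conv c) M'0 M'S n).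
  apply: le_trans (psum_M'_le1 c0 (NCsum0 c) (NCsum_conv c) M'0 M'S N (ltW r0) _) _.
    by rewrite rK.
  by rewrite (ler_nat _ 1 2).
have u0' : 1 - w * (c%:C - 1) - 2 * w * L != 0 by rewrite uE.
have hcv := psum_m'_cvg half_cvg0 r0C wr Mc0 McS Mc'0 Mc'S slowM slowM' slowd psumM2 w0 LD LM
  far_root u0'.
rewrite uE in hcv.
rewrite -cvg_shiftS.
have -> : (fun N => gsum c z N.+1) = (fun N => w * psum Mc' w N.+1).
  apply/funext => N; rewrite /gsum.
  rewrite (eq_big_nat _ _ (F2 := fun n => (M' n)%:C / z ^+ n.+1)) => [|n /andP[n0 _]].
    by rewrite series_psum M'0 subr0.
  by rewrite M'E.
have -> : (L - 1) / s ^+ 2 = w * (w * ((L - 1) / (s / z)) / (s / z)).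
  by rewrite /w; field; rewrite s0 z0.
have -> : (fun N => w * psum Mc' w N.+1) = (fun N => w * (psum Mc' w N.+1 - 0)).
  by apply/funext => N; rewrite subr0.
rewrite -[w * ((L - 1) / (s / z)) / (s / z)]subr0; apply: cvg_scaled_sub.
by move: hcv; rewrite -cvg_shiftS.
Qed.

Lemma transforms_at_point :
  [/\ cvgn (Gsum c z),
      mp_G c z = (z + 1 - c%:C - s) / (2 * z),
      cvgn (gsum c z),
      mp_g c z = (z * mp_G c z - 1) / mp_P c z
    & (z * mp_G c z - 1) / mp_P c z
      = 1 / 2 * (1 / 2 * (1 / (z - a) + 1 / (z - b)) - 1 / s)].
Proof.
have GE : mp_G c z = (z + 1 - c%:C - s) / (2 * z).
  rewrite /mp_G (cvg_lim (@norm_hausdorff _ _) Gsum_cvg) /w /L; by field.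
have zG : z * mp_G c z - 1 = L - 1 by rewrite GE /L; field.
split=> //.
- by apply/cvg_ex; exists (w * (L - 1)); exact: Gsum_cvg.
- by apply/cvg_ex; exists ((L - 1) / s ^+ 2); exact: gsum_cvg.
- by rewrite /mp_g (cvg_lim (@norm_hausdorff _ _) gsum_cvg) zG s2.
rewrite zG.
have P0 : (z - a) * (z - b) != 0 by rewrite mulf_neq0.
have ab : a + b = 2 * (1 + c%:C) by rewrite /a /b mp_aE mp_bE -sqrt_cE; ring.
have -> : 1 / (z - a) + 1 / (z - b) = 2 * (z - (1 + c%:C)) / s ^+ 2.
  rewrite s2 /mp_P -/a -/b.
  have -> : 2 * (z - (1 + c%:C)) = (z - a) + (z - b) by rewrite mulrBr -ab; ring.
  by field; rewrite za zb.
by rewrite -s2 /L; field.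
Qed.

End Point.
End Core.

Theorem theorem45 (R : realType) (c : R) (sqrtP : R[i]^o -> R[i]^o)
    (hc : 0 < c) (hsqrtP : is_sqrtP c sqrtP) :
  \forall z \near cinfty R,
    let a : R[i]^o := (mp_a c)%:C in
    let b : R[i]^o := (mp_b c)%:C in
    [/\ cvgn (Gsum c z),
        mp_G c z = (z + 1 - c%:C - sqrtP z) / (2 * z),
        cvgn (gsum c z),
        mp_g c z = (z * mp_G c z - 1) / mp_P c z
      & (z * mp_G c z - 1) / mp_P c z
        = 1 / 2 * (1 / 2 * (1 / (z - a) + 1 / (z - b)) - 1 / sqrtP z)].
Proof.
have [_ sq lim] := hsqrtP.
have big : \forall z \near cinfty R, (32 + 16 * c)%:C < `|z| by exists (32 + 16 * c).
have half0 : 0 < 1 / 2 :> R[i] by rewrite divr_gt0.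
have /cvgrPdist_lt /(_ _ half0) near1 := lim.
near=> z; have zB : (32 + 16 * c)%:C < `|z| by near: z.
apply: transforms_at_point => //; last by near: z.
apply: sq => -[t] /=; rewrite in_itv /= => /andP[at_ tb] tz.
have [/andP[a0 _] bB] := mp_ab_le hc.
move: zB; rewrite -tz ger0_norm ?ler0c ?(le_trans a0) // ltcR ltNge.
by rewrite (le_trans tb bB).
Unshelve. all: by end_near. Qed.
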